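(* Let $0<p<1/2$ and let $m=(m_0,m_1,\dots)$ be a bounded generating sequence. There is a constant $c_p<\infty$ (depending only on $p$ and $m$) such that for every martingale $f\in H_p(G_m)$, $$\Big\|\sup_{n\in\mathbb{N}_+}\frac{|\sigma_n f|}{(n+1)^{1/p-2}}\Big\|_{L_p(G_m)}\le c_p\,\|f\|_{H_p(G_m)}.$$ That is, the maximal operator $\widetilde{\sigma}_p^{*}f:=\sup_{n}|\sigma_n f|/(n+1)^{1/p-2}$ is bounded from $H_p(G_m)$ to $L_p(G_m)$.
   Context: Let $m=(m_0,m_1,\dots)$ be a sequence of integers $m_k\ge 2$ with $\sup_k m_k<\infty$ (bounded Vilenkin group). $Z_{m_k}=\{0,1,\dots,m_k-1\}$ is the additive group of integers mod $m_k$, and $G_m=\prod_k Z_{m_k}$ is the complete direct product, with elements $x=(x_0,x_1,\dots)$, $x_k\in Z_{m_k}$, product topology, and Haar measure $\mu$ = product of the uniform measures $\mu_k(\{j\})=1/m_k$, so $\mu(G_m)=1$. Set $M_0=1$, $M_{k+1}=m_kM_k$; every $n\in\mathbb{N}$ is uniquely $n=\sum_j n_jM_j$ with $n_j\in Z_{m_j}$. For $n\ge1$, $I_n(x)=\{y\in G_m: y_j=x_j,\ j<n\}$, $I_0(x)=G_m$, $I_n:=I_n(0)$. The generalized Rademacher functions are $r_k(x)=\exp(2\pi i x_k/m_k)$ and the Vilenkin system is $\psi_n=\prod_k r_k^{n_k}$. $\digamma_n$ is the $\sigma$-algebra generated by the intervals $I_n(x)$, $x\in G_m$. A martingale $f=(f^{(n)})$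 is with respect to $(\digamma_n)$; its maximal function is $f^*=\sup_n|f^{(n)}|$, and for $0<p<\infty$, $H_p(G_m)$ is the space of martingales with $\|f\|_{H_p}:=\|f^*\|_{L_p}<\infty$, where $\|g\|_{L_p}=(\int_{G_m}|g|^pd\mu)^{1/p}$. Fourier coefficients of a martingale are $\widehat f(i)=\lim_{k\to\infty}\int_{G_m}f^{(k)}\overline{\psi_i}\,d\mu$; partial sums $S_nf=\sum_{k=0}^{n-1}\widehat f(k)\psi_k$ ($S_0f=0$), Fejér means $\sigma_nf=\frac1n\sum_{k=0}^{n-1}S_kf$ ($n\ge1$). *)

(* Defs.v *)
(* classical reals.  Everything about G_m is reduced to finite
   sums over the cells of the sigma-algebras F_N. *)
From Stdlib Require Import Reals Lra ClassicalEpsilon.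
Open Scope R_scope.

Definition bounded_gen_seq (m : nat -> nat) : Prop :=
  (forall k, (2 <= m k)%nat) /\ exists B : nat, forall k, (m k <= B)%nat.

Fixpoint Mk (m : nat -> nat) (k : nat) : nat :=
  match k with O => 1%nat | S k' => (m k' * Mk m k')%nat end.

Definition digit (m : nat -> nat) (n k : nat) : nat := ((n / Mk m k) mod m k)%nat.

Definition in_Gm (m : nat -> nat) (x : nat -> nat) : Prop := forall k, (x k < m k)%nat.

Definition Cx := (R * R)%type.
Definition C0 : Cx := (0, 0).
Definition Cadd (z w : Cx) : Cx := (fst z + fst w, snd z + snd w).
Definition Cmul (z w : Cx) : Cx :=
  (fst z * fst w - snd z * snd w, fst z * snd w + snd z * fst w).
Definition Cscal (a : R) (z : Cx) : Cx := (a * fst z, a * snd z).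
Definition Cconj (z : Cx) : Cx := (fst z, - snd z).
Definition Cmod (z : Cx) : R := sqrt (fst z ^ 2 + snd z ^ 2).
Definition Cexpi (t : R) : Cx := (cos t, sin t).

Fixpoint Rsum (n : nat) (g : nat -> R) : R :=
  match n with O => 0 | S n' => Rsum n' g + g n' end.
Fixpoint Csum (n : nat) (g : nat -> Cx) : Cx :=
  match n with O => C0 | S n' => Cadd (Csum n' g) (g n') end.
Fixpoint Rmax_from (a len : nat) (g : nat -> R) : R :=
  match len with O => g a | S l => Rmax (Rmax_from a l g) (g (a + S l)%nat) end.

Definition Rlim (u : nat -> R) : R := epsilon (inhabits 0) (fun l => Un_cv u l).
Definition Clim (u : nat -> Cx) : Cx := (Rlim (fun k => fst (u k)), Rlim (fun k => snd (u k))).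

(* t^q for t >= 0 (with 0^q = 0, q > 0) *)
Definition rpow (t q : R) : R := if Rle_dec t 0 then 0 else Rpower t q.

(* psi_n(x) = prod_k r_k(x)^(n_k) = exp(2 pi i sum_k n_k x_k / m_k);
   n_k = 0 for k > n, so the sum over k <= n is the full sum. *)
Definition psi (m : nat -> nat) (n : nat) (x : nat -> nat) : Cx :=
  Cexpi (2 * PI * Rsum (S n) (fun k => INR (digit m n k) * INR (x k) / INR (m k))).

(* the representative point of the j-th cell I_L(x) (j < M_L) *)
Definition pt (m : nat -> nat) (L j : nat) : nat -> nat :=
  fun k => if Nat.ltb k L then digit m j k else 0%nat.
(* integral w.r.t. Haar measure of a function measurable w.r.t. F_L:
   each of the M_L cells has measure 1/M_L *)
Definition Rinteg (m : nat -> nat) (L : nat) (g : (nat -> nat) -> R) : R :=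
  / INR (Mk m L) * Rsum (Mk m L) (fun j => g (pt m L j)).
Definition Cinteg (m : nat -> nat) (L : nat) (g : (nat -> nat) -> Cx) : Cx :=
  Cscal (/ INR (Mk m L)) (Csum (Mk m L) (fun j => g (pt m L j))).

Definition measurable_at (m : nat -> nat) (n : nat) (g : (nat -> nat) -> Cx) : Prop :=
  forall x y, in_Gm m x -> in_Gm m y -> (forall k, (k < n)%nat -> x k = y k) -> g x = g y.

Definition upd (x : nat -> nat) (n j : nat) : nat -> nat :=
  fun k => if Nat.eqb k n then j else x k.

Definition is_martingale (m : nat -> nat) (f : nat -> (nat -> nat) -> Cx) : Prop :=
  (forall n, measurable_at m n (f n)) /\
  (forall n x, in_Gm m x ->
     f n x = Cscal (/ INR (m n)) (Csum (m n) (fun j => f (S n) (upd x n j)))).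

(* Fourier coefficients: hat f(i) = lim_k int f^(k) conj(psi_i) dmu;
   f^(k) conj(psi_i) is F_(k+i)-measurable *)
Definition fcoef (m : nat -> nat) (f : nat -> (nat -> nat) -> Cx) (i : nat) : Cx :=
  Clim (fun k => Cinteg m (k + i) (fun x => Cmul (f k x) (Cconj (psi m i x)))).

Definition Spart (m : nat -> nat) (f : nat -> (nat -> nat) -> Cx) (n : nat) (x : nat -> nat) : Cx :=
  Csum n (fun i => Cmul (fcoef m f i) (psi m i x)).
Definition fejer (m : nat -> nat) (f : nat -> (nat -> nat) -> Cx) (n : nat) (x : nat -> nat) : Cx :=
  Cscal (/ INR n) (Csum n (fun k => Spart m f k x)).

Definition Lp_at (m : nat -> nat) (p : R) (L : nat) (g : (nat -> nat) -> R) : R :=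
  rpow (Rinteg m L (fun x => rpow (g x) p)) (/ p).

Definition fstar_N (m : nat -> nat) (f : nat -> (nat -> nat) -> Cx) (N : nat) (x : nat -> nat) : R :=
  Rmax_from 0 N (fun n => Cmod (f n x)).

(* truncated weighted maximal operator  max_{1<=n<=N} |sigma_n f| / (n+1)^(1/p-2),
   (F_N-measurable), for N >= 1 *)
Definition sigstar_N (m : nat -> nat) (p : R) (f : nat -> (nat -> nat) -> Cx) (N : nat) (x : nat -> nat) : R :=
  Rmax_from 1 (N - 1) (fun n => Cmod (fejer m f n x) / Rpower (INR n + 1) (/ p - 2)).

(* ||f||_{H_p} <= B, i.e. ||sup_n |f^(n)| ||_p <= B
   (by monotone convergence, = sup_N || max_{n<=N} |f^(n)| ||_p) *)
Definition Hp_norm_le (m : nat -> nat) (p : R) (f : nat -> (nat -> nat) -> Cx) (B : R) : Prop :=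
  forall N, Lp_at m p N (fstar_N m f N) <= B.

Definition sigstar_norm_le (m : nat -> nat) (p : R) (f : nat -> (nat -> nat) -> Cx) (B : R) : Prop :=
  forall N, (1 <= N)%nat -> Lp_at m p N (sigstar_N m p f N) <= B.

(* Main.v *)
(** Kernel.  Splitting [n] at its leading digit gives a recursion for [n K_n], hence a
    majorant of [|n K_n|] built from indicators of cells.  Averaging it over a cell [Q] of
    level [K] costs at most a factor [n / M_K] for [n >= M_K], and the [p]-th power of the
    averaged kernel [wker K] has bounded integral because [p < 1/2].

    Martingale.  Call a cell [R] of level [n] principal if [lam R], the largest value of
    [|f^(n+1)|] on [R], is more than twice [lam] of the smallest principal cell strictly
    containing it.  Collecting the increments of [f] according to the smallest principal
    cell [Q] above them decomposes [f] into pieces supported on [Q], bounded by [4 lam Q]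
    and of mean zero on [Q] (unless [Q] is the whole group), so that [sigma_n] kills the
    piece of [Q] for [n <= M_K].  The sum of [lam Q ^ p] times the measure of [Q] is
    at most a constant times the integral of [f^* ^ p], since [lam] doubles along nested
    principal cells and is attained by [|f^(n+1)|] on a fixed proportion of [Q].
    As [p < 1], the [p]-th powers of the contributions of the pieces may be added. *)
Require Import Defs.
From Stdlib Require Import Reals Lra Lia Arith FunctionalExtensionality ClassicalEpsilon.
From Coquelicot Require Complex.
Open Scope R_scope.

(** * Finite sums and complex numbers *)

Lemma Rsum_ext n g h : (forall i, (i < n)%nat -> g i = h i) -> Rsum n g = Rsum n h.
Proof.
  induction n as [|n IH]; intros H; [reflexivity|simpl].
  rewrite IH, H; auto.
Qed.

Lemma Rsum_le n g h : (forall i, (i < n)%nat -> g i <= h i) -> Rsum n g <= Rsum n h.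
Proof.
  induction n as [|n IH]; intros H; simpl; [lra|].
  apply Rplus_le_compat; auto.
Qed.

Lemma Rsum_plus n g h : Rsum n (fun i => g i + h i) = Rsum n g + Rsum n h.
Proof. induction n as [|n IH]; simpl; [ring|rewrite IH; ring]. Qed.

Lemma Rsum_scal n a g : Rsum n (fun i => a * g i) = a * Rsum n g.
Proof. induction n as [|n IH]; simpl; [ring|rewrite IH; ring]. Qed.

Lemma Rsum_const n a : Rsum n (fun _ => a) = INR n * a.
Proof. induction n as [|n IH]; [simpl; ring|]. rewrite S_INR. simpl Rsum. rewrite IH. ring. Qed.

Lemma Rsum_zero n g : (forall i, (i < n)%nat -> g i = 0) -> Rsum n g = 0.
Proof. intros H. rewrite (Rsum_ext n g (fun _ => 0)), Rsum_const by auto. ring. Qed.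

Lemma Rsum_nonneg n g : (forall i, (i < n)%nat -> 0 <= g i) -> 0 <= Rsum n g.
Proof.
  intros H. replace 0 with (Rsum n (fun _ => 0)) by (rewrite Rsum_const; ring).
  now apply Rsum_le.
Qed.

Lemma Rsum_swap n k (g : nat -> nat -> R) :
  Rsum n (fun i => Rsum k (fun j => g i j)) = Rsum k (fun j => Rsum n (fun i => g i j)).
Proof.
  induction n as [|n IH]; simpl.
  - symmetry; apply Rsum_zero; auto.
  - now rewrite IH, <- Rsum_plus.
Qed.

Lemma Rsum_add a b g : Rsum (a + b) g = Rsum a g + Rsum b (fun i => g (a + i)%nat).
Proof.
  induction b as [|b IH]; [rewrite Nat.add_0_r; simpl; ring|].
  rewrite Nat.add_succ_r. simpl. rewrite IH. ring.
Qed.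

Lemma Rsum_mul a b g :
  Rsum (a * b) g = Rsum a (fun q => Rsum b (fun r => g (q * b + r)%nat)).
Proof.
  induction a as [|a IH]; [reflexivity|].
  rewrite Nat.mul_succ_l, Rsum_add, IH. reflexivity.
Qed.

Lemma Rsum_single n k g :
  (k < n)%nat -> (forall i, (i < n)%nat -> i <> k -> g i = 0) -> Rsum n g = g k.
Proof.
  induction n as [|n IH]; intros Hk H; [lia|]. simpl.
  destruct (Nat.eq_dec k n) as [->|Hne].
  - rewrite Rsum_zero; [ring|]. intros i Hi. apply H; lia.
  - rewrite IH, (H n); try lia; [ring|]. intros i Hi Hik. apply H; lia.
Qed.

Lemma Rsum_term_le n k g :
  (k < n)%nat -> (forall i, (i < n)%nat -> 0 <= g i) -> g k <= Rsum n g.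
Proof.
  induction n as [|n IH]; intros Hk H; [lia|]. simpl.
  destruct (Nat.eq_dec k n) as [->|Hne].
  - assert (0 <= Rsum n g) by (apply Rsum_nonneg; auto). lra.
  - assert (g k <= Rsum n g) by (apply IH; [lia|auto]).
    specialize (H n ltac:(lia)). lra.
Qed.

(** * Complex arithmetic on pairs of reals *)

Definition Cone : Cx := (1, 0).
Definition Copp (z : Cx) : Cx := (- fst z, - snd z).

Lemma Cx_ring : ring_theory C0 Cone Cadd Cmul (fun z w => Cadd z (Copp w)) Copp eq.
Proof.
  constructor; unfold C0, Cone, Cadd, Cmul, Copp; intros;
    try reflexivity; try (destruct x; simpl; f_equal; ring); simpl; f_equal; ring.
Qed.

Add Ring Cx_ring : Cx_ring.

(** Turns real scaling into a product, so that [ring] on [Cx] can treat it. *)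
Lemma Cscal_mul a z : Cscal a z = Cmul (a, 0) z.
Proof. unfold Cscal, Cmul; simpl; f_equal; ring. Qed.

Lemma Csum_fst n g : fst (Csum n g) = Rsum n (fun i => fst (g i)).
Proof. induction n as [|n IH]; simpl; [reflexivity|now rewrite IH]. Qed.

Lemma Csum_snd n g : snd (Csum n g) = Rsum n (fun i => snd (g i)).
Proof. induction n as [|n IH]; simpl; [reflexivity|now rewrite IH]. Qed.

Lemma Cx_eq (z w : Cx) : fst z = fst w -> snd z = snd w -> z = w.
Proof. destruct z, w; simpl; intros; subst; reflexivity. Qed.

Lemma Csum_ext n g h : (forall i, (i < n)%nat -> g i = h i) -> Csum n g = Csum n h.
Proof.
  induction n as [|n IH]; intros H; [reflexivity|simpl].
  rewrite IH, H; auto.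
Qed.

Lemma Csum_plus n g h : Csum n (fun i => Cadd (g i) (h i)) = Cadd (Csum n g) (Csum n h).
Proof. induction n as [|n IH]; simpl; [ring|rewrite IH; ring]. Qed.

Lemma Csum_mul_l n a g : Csum n (fun i => Cmul a (g i)) = Cmul a (Csum n g).
Proof. induction n as [|n IH]; simpl; [ring|rewrite IH; ring]. Qed.

Lemma Csum_mul_r n a g : Csum n (fun i => Cmul (g i) a) = Cmul (Csum n g) a.
Proof. induction n as [|n IH]; simpl; [ring|rewrite IH; ring]. Qed.

Lemma Csum_const n a : Csum n (fun _ => a) = Cscal (INR n) a.
Proof.
  rewrite Cscal_mul. induction n as [|n IH]; [apply Cx_eq; simpl; ring|].
  rewrite S_INR; simpl Csum; rewrite IH. apply Cx_eq; simpl; ring.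
Qed.

Lemma Csum_zero n g : (forall i, (i < n)%nat -> g i = C0) -> Csum n g = C0.
Proof.
  intros H. rewrite (Csum_ext n g (fun _ => C0)), Csum_const by auto.
  apply Cx_eq; simpl; ring.
Qed.

Lemma Csum_swap n k (g : nat -> nat -> Cx) :
  Csum n (fun i => Csum k (fun j => g i j)) = Csum k (fun j => Csum n (fun i => g i j)).
Proof.
  induction n as [|n IH]; simpl.
  - symmetry; apply Csum_zero; auto.
  - now rewrite IH, <- Csum_plus.
Qed.

Lemma Csum_add a b g : Csum (a + b) g = Cadd (Csum a g) (Csum b (fun i => g (a + i)%nat)).
Proof.
  induction b as [|b IH]; [rewrite Nat.add_0_r; simpl; ring|].
  rewrite Nat.add_succ_r. simpl. rewrite IH. ring.
Qed.

Lemma Csum_single n k g :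
  (k < n)%nat -> (forall i, (i < n)%nat -> i <> k -> g i = C0) -> Csum n g = g k.
Proof.
  intros Hk H. apply Cx_eq.
  - rewrite Csum_fst. rewrite (Rsum_single n k); auto. intros i Hi Hik. now rewrite H.
  - rewrite Csum_snd. rewrite (Rsum_single n k); auto. intros i Hi Hik. now rewrite H.
Qed.

Lemma Cmod_ge0 z : 0 <= Cmod z.
Proof. exact (Complex.Cmod_ge_0 z). Qed.

Lemma Cmod_add z w : Cmod (Cadd z w) <= Cmod z + Cmod w.
Proof. exact (Complex.Cmod_triangle z w). Qed.

Lemma Cmod_mul z w : Cmod (Cmul z w) = Cmod z * Cmod w.
Proof. exact (Complex.Cmod_mult z w). Qed.

Lemma Cmod_real a : Cmod (a, 0) = Rabs a.
Proof. exact (Complex.Cmod_R a). Qed.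

Lemma Cmod_zero : Cmod C0 = 0.
Proof. exact Complex.Cmod_0. Qed.

Lemma Cmod_scal a z : Cmod (Cscal a z) = Rabs a * Cmod z.
Proof. now rewrite Cscal_mul, Cmod_mul, Cmod_real. Qed.

Lemma Cmod_opp z : Cmod (Copp z) = Cmod z.
Proof. exact (Complex.Cmod_opp z). Qed.

Lemma Cmod_Cexpi t : Cmod (Cexpi t) = 1.
Proof.
  unfold Cmod, Cexpi; simpl fst; simpl snd.
  replace (cos t ^ 2 + sin t ^ 2) with 1; [apply sqrt_1|].
  pose proof (sin2_cos2 t). unfold Rsqr in *. lra.
Qed.

Lemma Cexpi_plus s t : Cexpi (s + t) = Cmul (Cexpi s) (Cexpi t).
Proof. apply Cx_eq; simpl; [rewrite cos_plus|rewrite sin_plus]; ring. Qed.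

Lemma Cconj_Cexpi t : Cconj (Cexpi t) = Cexpi (- t).
Proof. apply Cx_eq; simpl; [now rewrite cos_neg|now rewrite sin_neg]. Qed.

Lemma Cmod_Csum n g : Cmod (Csum n g) <= Rsum n (fun i => Cmod (g i)).
Proof.
  induction n as [|n IH]; simpl; [rewrite Cmod_zero; lra|].
  eapply Rle_trans; [apply Cmod_add|lra].
Qed.

(** * Integrals over the cells *)

(* [measurable_at] for functions with values in an arbitrary type *)
Definition fdep {T} (m : nat -> nat) (n : nat) (g : (nat -> nat) -> T) : Prop :=
  forall x y, in_Gm m x -> in_Gm m y -> (forall k, (k < n)%nat -> x k = y k) -> g x = g y.

Lemma upd_eq x n j : upd x n j n = j.
Proof. unfold upd. now rewrite Nat.eqb_refl. Qed.

Lemma upd_neq x n j k : k <> n -> upd x n j k = x k.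
Proof. intros H. unfold upd. apply Nat.eqb_neq in H. now rewrite H. Qed.

Section Vilenkin.
Context (m : nat -> nat) (hm : forall k, (2 <= m k)%nat).

Definition Mreal k := INR (Mk m k).

Lemma Mk_pos k : (0 < Mk m k)%nat.
Proof. clear - hm. induction k as [|k IH]; simpl; [lia|]. specialize (hm k). nia. Qed.

Lemma Mk_gt k : (k < Mk m k)%nat.
Proof. clear - hm. induction k as [|k IH]; simpl; [lia|]. specialize (hm k). nia. Qed.

Lemma Mk_factor k l : (k <= l)%nat -> exists c, Mk m l = (c * Mk m k)%nat.
Proof.
  intros H. induction H as [|l H [c IH]]; [exists 1%nat; lia|].
  exists (m l * c)%nat. simpl. rewrite IH. lia.
Qed.

Lemma Mk_le k l : (k <= l)%nat -> (Mk m k <= Mk m l)%nat.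
Proof.
  intros H. destruct (Mk_factor k l H) as [c Hc].
  pose proof (Mk_pos l). pose proof (Mk_pos k). destruct c; nia.
Qed.

Lemma MR_pos k : 0 < Mreal k.
Proof. apply lt_0_INR, Mk_pos. Qed.

Lemma MR_ge1 k : 1 <= Mreal k.
Proof. apply (le_INR 1), Mk_pos. Qed.

Lemma MR_S k : Mreal (S k) = INR (m k) * Mreal k.
Proof. unfold Mreal; simpl. apply mult_INR. Qed.

Lemma m_ge2 k : 2 <= INR (m k).
Proof. apply (le_INR 2), hm. Qed.

Lemma MR_double k : 2 * Mreal k <= Mreal (S k).
Proof. rewrite MR_S. pose proof (m_ge2 k). pose proof (MR_pos k). nra. Qed.

Lemma MR_le k l : (k <= l)%nat -> Mreal k <= Mreal l.
Proof. intros H. now apply le_INR, Mk_le. Qed.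

Lemma in_Gm_pt L j : in_Gm m (pt m L j).
Proof.
  intros k. unfold pt, digit. pose proof (hm k).
  destruct (Nat.ltb k L); [apply Nat.mod_upper_bound|]; lia.
Qed.

Lemma in_Gm_upd x n j : in_Gm m x -> (j < m n)%nat -> in_Gm m (upd x n j).
Proof.
  intros Hx Hj k. unfold upd. destruct (Nat.eqb_spec k n); subst; auto.
Qed.

Lemma digit_low A b i k : (k < A)%nat -> digit m (b * Mk m A + i) k = digit m i k.
Proof.
  intros H. destruct (Mk_factor (S k) A H) as [c Hc]. unfold digit. rewrite Hc. simpl Mk.
  replace (b * (c * (m k * Mk m k)) + i)%nat with ((b * c * m k) * Mk m k + i)%nat by ring.
  pose proof (Mk_pos k). pose proof (hm k).
  rewrite Nat.div_add_l by lia. rewrite Nat.add_comm, Nat.Div0.mod_add. reflexivity.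
Qed.

Lemma digit_top A b i : (i < Mk m A)%nat -> (b < m A)%nat -> digit m (b * Mk m A + i) A = b.
Proof.
  intros Hi Hb. unfold digit. pose proof (Mk_pos A).
  rewrite Nat.div_add_l, (Nat.div_small i) by lia.
  rewrite Nat.add_0_r. now apply Nat.mod_small.
Qed.

Lemma digit_high i A k : (i < Mk m A)%nat -> (A <= k)%nat -> digit m i k = 0%nat.
Proof.
  intros Hi Hk. pose proof (Mk_le A k Hk). unfold digit.
  rewrite Nat.div_small by lia. apply Nat.Div0.mod_0_l.
Qed.

(** The index [q * M_L + r] has top digit [q] and the lower digits of [r], so these indices
    enumerate the children of the cell [r]. *)
Lemma pt_S L q r : (r < Mk m L)%nat -> (q < m L)%nat ->
  pt m (S L) (q * Mk m L + r) = upd (pt m L r) L q.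
Proof.
  intros Hr Hq. extensionality k. unfold pt, upd.
  destruct (Nat.eqb_spec k L) as [->|Hk].
  - rewrite (proj2 (Nat.ltb_lt L (S L))) by lia. now apply digit_top.
  - destruct (Nat.ltb_spec k L), (Nat.ltb_spec k (S L)); try lia; auto.
    now apply digit_low.
Qed.

(** Fubini in the last coordinate: by [pt_S], the cells of level [L + 1] are grouped by their
    parent. *)
Lemma Rinteg_S L g :
  Rinteg m (S L) g =
  Rinteg m L (fun x => / INR (m L) * Rsum (m L) (fun q => g (upd x L q))).
Proof.
  unfold Rinteg. simpl Mk. rewrite Rsum_mul, Rsum_swap, Rsum_scal, mult_INR.
  pose proof (m_ge2 L). pose proof (MR_pos L). unfold Mreal in *.
  rewrite (Rsum_ext (Mk m L) _ (fun j => Rsum (m L) (fun q => g (upd (pt m L j) L q)))).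
  - field. lra.
  - intros r Hr. apply Rsum_ext. intros q Hq. now rewrite pt_S.
Qed.

Lemma Rinteg_ext L g h : (forall x, in_Gm m x -> g x = h x) -> Rinteg m L g = Rinteg m L h.
Proof.
  intros H. unfold Rinteg. f_equal. apply Rsum_ext. intros. apply H, in_Gm_pt.
Qed.

Lemma Rinteg_le L g h : (forall x, in_Gm m x -> g x <= h x) -> Rinteg m L g <= Rinteg m L h.
Proof.
  intros H. unfold Rinteg. pose proof (MR_pos L).
  apply Rmult_le_compat_l; [apply Rlt_le, Rinv_0_lt_compat; auto|].
  apply Rsum_le. intros. apply H, in_Gm_pt.
Qed.

Lemma Rinteg_plus L g h : Rinteg m L (fun x => g x + h x) = Rinteg m L g + Rinteg m L h.
Proof. unfold Rinteg. rewrite Rsum_plus. ring. Qed.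

Lemma Rinteg_scal L a g : Rinteg m L (fun x => a * g x) = a * Rinteg m L g.
Proof. unfold Rinteg. rewrite Rsum_scal. ring. Qed.

Lemma Rinteg_const L a : Rinteg m L (fun _ => a) = a.
Proof.
  unfold Rinteg. rewrite Rsum_const. pose proof (MR_pos L). unfold Mreal in *. field. lra.
Qed.

Lemma Rinteg_sum L n (g : nat -> (nat -> nat) -> R) :
  Rinteg m L (fun x => Rsum n (fun i => g i x)) = Rsum n (fun i => Rinteg m L (g i)).
Proof. unfold Rinteg. now rewrite Rsum_swap, Rsum_scal. Qed.

Lemma Rinteg_nonneg L g : (forall x, in_Gm m x -> 0 <= g x) -> 0 <= Rinteg m L g.
Proof. intros H. rewrite <- (Rinteg_const L 0). now apply Rinteg_le. Qed.

(** Averaging over a coordinate on which [g] does not depend changes nothing; hence the level of a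
    finite integral may be chosen freely once it is large enough. *)
Lemma Rinteg_dep K N g : fdep m K g -> (K <= N)%nat -> Rinteg m N g = Rinteg m K g.
Proof.
  intros Hg HN. induction HN as [|N HN IH]; [reflexivity|].
  rewrite Rinteg_S, <- IH. apply Rinteg_ext. intros x Hx.
  rewrite (Rsum_ext _ _ (fun _ => g x)).
  - rewrite Rsum_const. pose proof (m_ge2 N). field. lra.
  - intros q Hq. apply Hg; auto using in_Gm_upd.
    intros k Hk. apply upd_neq. lia.
Qed.

Lemma Cinteg_fst L g : fst (Cinteg m L g) = Rinteg m L (fun x => fst (g x)).
Proof. unfold Cinteg, Rinteg, Cscal. simpl. now rewrite Csum_fst. Qed.

Lemma Cinteg_snd L g : snd (Cinteg m L g) = Rinteg m L (fun x => snd (g x)).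
Proof. unfold Cinteg, Rinteg, Cscal. simpl. now rewrite Csum_snd. Qed.

Lemma Cinteg_ext L g h : (forall x, in_Gm m x -> g x = h x) -> Cinteg m L g = Cinteg m L h.
Proof.
  intros H. unfold Cinteg. f_equal. apply Csum_ext. intros. apply H, in_Gm_pt.
Qed.

Lemma Cinteg_S L g :
  Cinteg m (S L) g =
  Cinteg m L (fun x => Cscal (/ INR (m L)) (Csum (m L) (fun q => g (upd x L q)))).
Proof.
  apply Cx_eq; rewrite ?Cinteg_fst, ?Cinteg_snd, Rinteg_S; apply Rinteg_ext;
    intros x _; simpl; now rewrite ?Csum_fst, ?Csum_snd.
Qed.

Lemma Cinteg_dep K N g : fdep m K g -> (K <= N)%nat -> Cinteg m N g = Cinteg m K g.
Proof.
  intros Hg HN. apply Cx_eq; rewrite ?Cinteg_fst, ?Cinteg_snd; apply Rinteg_dep; auto;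
    intros x y Hx Hy H; now rewrite (Hg x y).
Qed.

Lemma Cinteg_mul_l L a g : Cinteg m L (fun x => Cmul a (g x)) = Cmul a (Cinteg m L g).
Proof. unfold Cinteg. rewrite Csum_mul_l, !Cscal_mul. ring. Qed.

Lemma Cinteg_sum L n (g : nat -> (nat -> nat) -> Cx) :
  Cinteg m L (fun x => Csum n (fun i => g i x)) = Csum n (fun i => Cinteg m L (g i)).
Proof.
  unfold Cinteg. rewrite Csum_swap, Cscal_mul, <- Csum_mul_l.
  apply Csum_ext. intros. now rewrite Cscal_mul.
Qed.

Lemma Cinteg_zero L g : (forall x, in_Gm m x -> g x = C0) -> Cinteg m L g = C0.
Proof.
  intros H. unfold Cinteg. rewrite Csum_zero by (intros; apply H, in_Gm_pt).
  rewrite Cscal_mul. ring.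
Qed.

Lemma Cmod_Cinteg L g : Cmod (Cinteg m L g) <= Rinteg m L (fun x => Cmod (g x)).
Proof.
  unfold Cinteg, Rinteg. rewrite Cmod_scal. pose proof (MR_pos L).
  assert (0 < / INR (Mk m L)) by (apply Rinv_0_lt_compat; auto).
  rewrite Rabs_pos_eq by lra. apply Rmult_le_compat_l; [lra|apply Cmod_Csum].
Qed.

Lemma fdep_cond K {T} (g : (nat -> nat) -> T) x q :
  fdep m K g -> in_Gm m x -> (q < m K)%nat -> g (upd x K q) = g x.
Proof.
  intros Hg Hx Hq. apply Hg; auto using in_Gm_upd. intros k Hk. apply upd_neq. lia.
Qed.

Definition eqi (a b : nat) : R := if Nat.eqb a b then 1 else 0.

Lemma eqi_nonneg a b : 0 <= eqi a b.
Proof. unfold eqi; destruct (Nat.eqb a b); lra. Qed.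

(* A condition on the next coordinate is independent of the previous ones. *)
Lemma Rinteg_eqi A N (c : nat) g :
  fdep m A g -> (A < N)%nat -> (c < m A)%nat ->
  Rinteg m N (fun t => eqi c (t A) * g t) = / INR (m A) * Rinteg m N g.
Proof.
  intros Hg HA Hc.
  rewrite (Rinteg_dep (S A) N); [|..|lia].
  - rewrite Rinteg_S, (Rinteg_dep A N g), <- Rinteg_scal; auto; [|lia].
    apply Rinteg_ext. intros x Hx. f_equal.
    rewrite (Rsum_single _ c); auto.
    + rewrite upd_eq. unfold eqi. rewrite Nat.eqb_refl, fdep_cond; auto. ring.
    + intros i Hi Hic. rewrite upd_eq. unfold eqi.
      destruct (Nat.eqb_spec c i); [lia|ring].
  - intros x y Hx Hy H. rewrite (H A), (Hg x y); auto.
Qed.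

End Vilenkin.

(** * Dirichlet and Fejer kernels *)

Section Kernels.
Context (m : nat -> nat) (hm : forall k, (2 <= m k)%nat).

Lemma Rsum_trunc a b g : (a <= b)%nat -> (forall k, (a <= k)%nat -> g k = 0) ->
  Rsum b g = Rsum a g.
Proof.
  intros Hab H. replace b with (a + (b - a))%nat by lia.
  rewrite Rsum_add, (Rsum_zero (b - a)); [ring|]. intros; apply H; lia.
Qed.

Definition phase (L i : nat) (x : nat -> nat) : R :=
  Rsum L (fun k => INR (digit m i k) * INR (x k) / INR (m k)).

(** The digits of [i] from [L] on vanish, so the phase can be cut at [L] instead of [S i]; this
    shows on which coordinates [psi_i] depends. *)
Lemma psi_phase L i x : (i < Mk m L)%nat -> psi m i x = Cexpi (2 * PI * phase L i x).
Proof.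
  intros Hi. unfold psi. f_equal. f_equal. unfold phase.
  pose proof (Mk_gt m hm (S i)).
  destruct (Nat.le_ge_cases (S i) L) as [HL|HL]; [symmetry|]; apply Rsum_trunc; auto;
    intros k Hk.
  - rewrite (digit_high m hm i (S i)) by lia. simpl. unfold Rdiv; ring.
  - rewrite (digit_high m hm i L) by lia. simpl. unfold Rdiv; ring.
Qed.

Lemma psi_fdep L i : (i < Mk m L)%nat -> fdep m L (psi m i).
Proof.
  intros Hi x y _ _ H. rewrite !(psi_phase L i) by auto. f_equal. f_equal.
  apply Rsum_ext. intros k Hk. now rewrite H.
Qed.

(* [chi i], [dir n], [fej n] at [x], [t] are [psi_i], [D_n] and [n K_n] at [x - t]. *)
Definition chi (i : nat) (x t : nat -> nat) : Cx := Cmul (psi m i x) (Cconj (psi m i t)).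

(* [r_A(x)^b] times the conjugate of [r_A(t)^b] *)
Definition rad (A b : nat) (x t : nat -> nat) : Cx :=
  Cexpi (INR b * (2 * PI * (INR (x A) - INR (t A)) / INR (m A))).

Definition dir (n : nat) (x t : nat -> nat) : Cx := Csum n (fun i => chi i x t).

Definition fej (n : nat) (x t : nat -> nat) : Cx := Csum n (fun k => dir k x t).

(** The digits of [b * M_A + i] are [b] at place [A] and those of [i] below, so the phases add. *)
Lemma chi_block A b i x t : (i < Mk m A)%nat -> (b < m A)%nat ->
  chi (b * Mk m A + i) x t = Cmul (rad A b x t) (chi i x t).
Proof.
  intros Hi Hb. unfold chi, rad.
  assert (Hbi : (b * Mk m A + i < Mk m (S A))%nat) by (simpl; nia).
  rewrite !(psi_phase (S A) _ _ Hbi), !(psi_phase A i), !Cconj_Cexpi, <- !Cexpi_plus by auto.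
  f_equal. unfold phase. simpl Rsum.
  rewrite (digit_top m hm) by auto.
  assert (Hlow : forall y, Rsum A (fun k => INR (digit m (b * Mk m A + i) k) * INR (y k) / INR (m k))
                      = Rsum A (fun k => INR (digit m i k) * INR (y k) / INR (m k))).
  { intros y. apply Rsum_ext. intros k Hk. now rewrite (digit_low m hm). }
  rewrite !Hlow.
  unfold Rdiv. ring.
Qed.

Lemma Cmod_rad A b x t : Cmod (rad A b x t) = 1.
Proof. apply Cmod_Cexpi. Qed.

Lemma cos_lt_1 u : 0 < u < 2 * PI -> cos u < 1.
Proof.
  intros Hu. replace u with (2 * (u / 2)) by field. rewrite cos_2a_sin.
  assert (0 < sin (u / 2)) by (apply sin_gt_0; lra). nra.
Qed.

(** If [a <> b], multiplying the geometric sum by [exp(iu) - 1] telescopes to [exp(iMu) - 1 = 0],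
    while [exp(iu) <> 1] because [0 < |a - b| < M]. *)
Lemma sum_roots (M a b : nat) : (a < M)%nat -> (b < M)%nat ->
  Csum M (fun s => Cexpi (INR s * (2 * PI * (INR a - INR b) / INR M))) =
  Cscal (INR M * eqi a b) Cone.
Proof.
  intros Ha Hb. assert (HM : 0 < INR M) by (apply lt_0_INR; lia).
  unfold eqi. destruct (Nat.eqb_spec a b) as [->|Hab].
  - rewrite (Csum_ext _ _ (fun _ => Cone)), Csum_const; [now rewrite Rmult_1_r|].
    intros s _. replace (INR s * _) with 0 by (field; lra).
    unfold Cexpi. now rewrite cos_0, sin_0.
  - set (u := 2 * PI * (INR a - INR b) / INR M).
    assert (Hu : cos u <> 1).
    { pose proof PI_RGT_0. pose proof (lt_INR _ _ Ha). pose proof (lt_INR _ _ Hb).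
      pose proof (pos_INR a). pose proof (pos_INR b).
      assert (Hv : forall c d : nat, (c < d)%nat -> (d < M)%nat ->
                cos (2 * PI * (INR d - INR c) / INR M) < 1).
      { intros c d Hcd Hd. apply cos_lt_1. apply lt_INR in Hcd, Hd. pose proof (pos_INR c).
        assert (0 < (INR d - INR c) / INR M < 1).
        { split; [apply Rdiv_lt_0_compat; lra|]. apply Rmult_lt_reg_r with (INR M); auto.
          unfold Rdiv. rewrite Rmult_assoc, Rinv_l; lra. }
        replace (2 * PI * (INR d - INR c) / INR M)
          with (2 * PI * ((INR d - INR c) / INR M)) by (unfold Rdiv; ring).
        nra. }
      destruct (Nat.lt_ge_cases b a) as [Hlt|Hge].
      - specialize (Hv b a Hlt Ha). unfold u. lra.
      - specialize (Hv a b ltac:(lia) Hb). unfold u. rewrite <- cos_neg.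
        replace (- (2 * PI * (INR a - INR b) / INR M))
          with (2 * PI * (INR b - INR a) / INR M) by (unfold Rdiv; ring). lra. }
    set (z := Cadd (Cexpi u) (Copp Cone)).
    assert (Hgeo : forall n, Cmul z (Csum n (fun s => Cexpi (INR s * u))) =
                             Cadd (Cexpi (INR n * u)) (Copp Cone)).
    { induction n as [|n IH].
      - simpl. rewrite Rmult_0_l. unfold Cexpi. rewrite cos_0, sin_0. unfold Cone.
        apply Cx_eq; simpl; ring.
      - rewrite S_INR. simpl Csum.
        transitivity (Cadd (Cmul z (Csum n (fun s => Cexpi (INR s * u))))
                           (Cmul z (Cexpi (INR n * u)))); [ring|].
        rewrite IH, Rmult_plus_distr_r, Rmult_1_l, Cexpi_plus. unfold z. ring. }
    assert (Hz : Cmul z (Csum M (fun s => Cexpi (INR s * u))) = C0).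
    { rewrite Hgeo. replace (INR M * u) with (2 * (PI * INR a) - 2 * (PI * INR b))
        by (unfold u; field; lra).
      assert (Hp : forall k, cos (2 * (PI * INR k)) = 1 /\ sin (2 * (PI * INR k)) = 0).
      { intros k. pose proof (cos_period 0 k). pose proof (sin_period 0 k).
        replace (0 + 2 * INR k * PI) with (2 * (PI * INR k)) in * by ring.
        rewrite cos_0, sin_0 in *. auto. }
      destruct (Hp a), (Hp b). apply Cx_eq; simpl; [rewrite cos_minus|rewrite sin_minus]; nra. }
    assert (Hm : Cmod z * Cmod (Csum M (fun s => Cexpi (INR s * u))) = 0).
    { rewrite <- Cmod_mul, Hz. apply Cmod_zero. }
    apply Rmult_integral in Hm. destruct Hm as [Hm|Hm].
    + apply (Complex.Cmod_eq_0 z) in Hm. apply (f_equal fst) in Hm. simpl in Hm. lra.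
    + apply (Complex.Cmod_eq_0 (Csum M _)) in Hm. rewrite Hm. apply Cx_eq; simpl; ring.
Qed.

Lemma sum_rad A x t : in_Gm m x -> in_Gm m t ->
  Csum (m A) (fun b => rad A b x t) = Cscal (INR (m A) * eqi (x A) (t A)) Cone.
Proof. intros Hx Ht. now apply sum_roots. Qed.

(** The case [i = M_A] of a complete block is allowed, since [dir_mul] proceeds by complete
    blocks. *)
Lemma dir_block A b i x t : (i <= Mk m A)%nat -> (b < m A)%nat ->
  dir (b * Mk m A + i) x t =
  Cadd (dir (b * Mk m A) x t) (Cmul (rad A b x t) (dir i x t)).
Proof.
  intros Hi Hb. unfold dir. rewrite Csum_add, <- Csum_mul_l. f_equal.
  apply Csum_ext. intros j Hj. apply chi_block; lia.
Qed.

Lemma dir_mul A b x t : (b <= m A)%nat ->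
  dir (b * Mk m A) x t = Cmul (Csum b (fun s => rad A s x t)) (dir (Mk m A) x t).
Proof.
  induction b as [|b IH]; intros Hb; [unfold dir; simpl; ring|].
  rewrite Nat.mul_succ_l, dir_block, IH by lia. simpl. ring.
Qed.

(** The indicator that [x] and [t] share a cell of level [A], built as a product so that coordinates
    can be peeled off one at a time. *)
Fixpoint cell (A : nat) (x t : nat -> nat) : R :=
  match A with O => 1 | S A' => eqi (x A') (t A') * cell A' x t end.

Lemma cell_nonneg A x t : 0 <= cell A x t.
Proof.
  induction A as [|A IH]; simpl; [lra|]. apply Rmult_le_pos; auto using eqi_nonneg.
Qed.

(** Paley's lemma. Each level contributes a full sum of roots of unity, that is [m_A] times the
    indicator that the coordinates agree. *)
Lemma dir_Mk A x t : in_Gm m x -> in_Gm m t ->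
  dir (Mk m A) x t = Cscal (Mreal m A * cell A x t) Cone.
Proof.
  intros Hx Ht. induction A as [|A IH].
  - unfold dir, Mreal, chi. simpl. rewrite !(psi_phase 0 0) by (simpl; lia).
    unfold phase; simpl. rewrite Rmult_0_r. unfold Cexpi. rewrite cos_0, sin_0.
    apply Cx_eq; simpl; ring.
  - simpl Mk. rewrite dir_mul, sum_rad, IH by auto. rewrite MR_S. simpl cell.
    apply Cx_eq; simpl; ring.
Qed.

Lemma Cmod_sum_rad A n x t : Cmod (Csum n (fun s => rad A s x t)) <= INR n.
Proof.
  eapply Rle_trans; [apply Cmod_Csum|].
  rewrite (Rsum_ext n _ (fun _ => 1)), Rsum_const; [lra|].
  intros; apply Cmod_rad.
Qed.

Lemma Cmod_Cone : Cmod Cone = 1.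
Proof. unfold Cone. rewrite Cmod_real. apply Rabs_R1. Qed.

Lemma Cmod_dir_mul A b x t : in_Gm m x -> in_Gm m t -> (b <= m A)%nat ->
  Cmod (dir (b * Mk m A) x t) <= INR b * (Mreal m A * cell A x t).
Proof.
  intros Hx Ht Hb. rewrite dir_mul, Cmod_mul, dir_Mk, Cmod_scal, Cmod_Cone by auto.
  pose proof (MR_pos m hm A). pose proof (cell_nonneg A x t).
  rewrite Rabs_pos_eq, Rmult_1_r by nra.
  apply Rmult_le_compat_r; [nra|apply Cmod_sum_rad].
Qed.

(** In each of the last [i] Dirichlet kernels [dir_block] splits off the same [dir (b * M_A)], and
    the remainders sum to a rotated [fej i]. *)
Lemma fej_block A b i x t : (i <= Mk m A)%nat -> (b < m A)%nat ->
  fej (b * Mk m A + i) x t =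
  Cadd (Cadd (fej (b * Mk m A) x t) (Cscal (INR i) (dir (b * Mk m A) x t)))
       (Cmul (rad A b x t) (fej i x t)).
Proof.
  intros Hi Hb. unfold fej. rewrite Csum_add, <- Csum_mul_l, <- Csum_const.
  rewrite (Csum_ext i _ (fun j => Cadd (dir (b * Mk m A) x t)
                                      (Cmul (rad A b x t) (dir j x t)))).
  - rewrite Csum_plus. ring.
  - intros j Hj. apply dir_block; lia.
Qed.

Lemma fej_mul A b x t : (b <= m A)%nat ->
  fej (b * Mk m A) x t =
  Cadd (Cscal (Mreal m A) (Csum b (fun s => dir (s * Mk m A) x t)))
       (Cmul (Csum b (fun s => rad A s x t)) (fej (Mk m A) x t)).
Proof.
  induction b as [|b IH]; intros Hb.
  - unfold fej; simpl. apply Cx_eq; simpl; ring.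
  - rewrite Nat.mul_succ_l, fej_block, IH by lia. rewrite !Cscal_mul.
    unfold Mreal. simpl. ring.
Qed.

(** * Majorants of the Fejer kernels *)

Context (B : R) (hB : forall k, INR (m k) <= B).

Lemma B_ge2 : 2 <= B.
Proof. pose proof (hB 0). pose proof (m_ge2 m hm 0). lra. Qed.

Lemma Cmod_sum_dir A n x t : in_Gm m x -> in_Gm m t -> (n <= m A)%nat ->
  Cmod (Csum n (fun s => dir (s * Mk m A) x t)) <= B ^ 2 * (Mreal m A * cell A x t).
Proof.
  intros Hx Ht Hn. pose proof (MR_pos m hm A). pose proof (cell_nonneg A x t).
  pose proof B_ge2. pose proof (hB A). pose proof (le_INR _ _ Hn). pose proof (pos_INR n).
  assert (0 <= Mreal m A * cell A x t) by nra.
  eapply Rle_trans; [apply Cmod_Csum|].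
  apply Rle_trans with (Rsum n (fun _ => B * (Mreal m A * cell A x t))).
  - apply Rsum_le. intros s Hs. eapply Rle_trans; [apply Cmod_dir_mul; auto; lia|].
    apply Rmult_le_compat_r; auto. assert (INR s <= INR n) by (apply le_INR; lia). lra.
  - rewrite Rsum_const, <- Rmult_assoc. apply Rmult_le_compat_r; nra.
Qed.

(** Majorant for [n = M_A]. The sum of roots in [fej_mul] over all [m_A] blocks is [m_A] times an
    indicator; keeping that indicator is what yields the factor [m_A ^ (p - 1) < 1] in
    [integ_majM_pow]. *)
Fixpoint fej_block_bound (A : nat) (x t : nat -> nat) : R :=
  match A with
  | O => 0
  | S A' => INR (m A') * eqi (x A') (t A') * fej_block_bound A' x t
            + B ^ 2 * Mreal m A' ^ 2 * cell A' x t
  end.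

(** Majorant for all [n < M_A] at once. With [n = b * M_A' + i], the summands bound the rotated
    [fej i], the term with [fej M_A'], and the two terms made of Dirichlet kernels, each at most
    [B ^ 2 * M_A' ^ 2] on the cell; hence the factor 2. *)
Fixpoint fej_bound (A : nat) (x t : nat -> nat) : R :=
  match A with
  | O => 0
  | S A' => fej_bound A' x t + B * fej_block_bound A' x t + 2 * B ^ 2 * Mreal m A' ^ 2 * cell A' x t
  end.

Lemma majM_nonneg A x t : 0 <= fej_block_bound A x t.
Proof.
  induction A as [|A IH]; simpl; [lra|].
  pose proof (eqi_nonneg (x A) (t A)). pose proof (cell_nonneg A x t).
  pose proof (MR_pos m hm A). pose proof B_ge2. pose proof (pos_INR (m A)).
  apply Rplus_le_le_0_compat; repeat apply Rmult_le_pos; try lra.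
Qed.

Lemma maj_nonneg A x t : 0 <= fej_bound A x t.
Proof.
  induction A as [|A IH]; simpl; [lra|].
  pose proof (majM_nonneg A x t). pose proof (cell_nonneg A x t).
  pose proof (MR_pos m hm A). pose proof B_ge2.
  repeat apply Rplus_le_le_0_compat; repeat apply Rmult_le_pos; try lra.
Qed.

Lemma Cmod_fej_Mk A x t : in_Gm m x -> in_Gm m t -> Cmod (fej (Mk m A) x t) <= fej_block_bound A x t.
Proof.
  intros Hx Ht. induction A as [|A IH].
  - replace (fej (Mk m 0) x t) with C0 by (unfold fej, dir; apply Cx_eq; simpl; ring).
    rewrite Cmod_zero. simpl. lra.
  - simpl Mk. rewrite fej_mul, sum_rad by auto. simpl fej_block_bound.
    eapply Rle_trans; [apply Cmod_add|]. rewrite Cmod_scal, Cmod_mul, Cmod_scal, Cmod_Cone.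
    pose proof (MR_pos m hm A). pose proof (eqi_nonneg (x A) (t A)).
    pose proof (pos_INR (m A)).
    rewrite !Rabs_pos_eq by nra.
    pose proof (Cmod_sum_dir A (m A) x t Hx Ht (le_n _)).
    assert (0 <= INR (m A) * eqi (x A) (t A)) by nra.
    assert (Mreal m A * Cmod (Csum (m A) (fun s => dir (s * Mk m A) x t)) <=
            Mreal m A * (B ^ 2 * (Mreal m A * cell A x t))) by (apply Rmult_le_compat_l; lra).
    assert (INR (m A) * eqi (x A) (t A) * Cmod (fej (Mk m A) x t) <=
            INR (m A) * eqi (x A) (t A) * fej_block_bound A x t) by (apply Rmult_le_compat_l; lra).
    lra.
Qed.

Lemma Cmod_fej A n x t : in_Gm m x -> in_Gm m t -> (n < Mk m A)%nat ->
  Cmod (fej n x t) <= fej_bound A x t.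
Proof.
  intros Hx Ht. revert n. induction A as [|A IH]; intros n Hn.
  - simpl in Hn. replace n with 0%nat by lia. unfold fej; simpl. rewrite Cmod_zero. lra.
  - pose proof (Mk_pos m hm A) as HA. simpl in Hn.
    set (b := (n / Mk m A)%nat). set (i := (n mod Mk m A)%nat).
    assert (Hi : (i < Mk m A)%nat) by (apply Nat.mod_upper_bound; lia).
    assert (Hn' : n = (b * Mk m A + i)%nat).
    { unfold b, i. rewrite (Nat.div_mod_eq n (Mk m A)) at 1. lia. }
    assert (Hb : (b < m A)%nat) by (apply Nat.Div0.div_lt_upper_bound; lia).
    rewrite Hn', fej_block, fej_mul by lia.
    pose proof (MR_pos m hm A). pose proof B_ge2. pose proof (hB A).
    assert (Hbm : INR b + 1 <= INR (m A)) by (rewrite <- S_INR; apply le_INR; lia).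
    pose proof (pos_INR b). pose proof (pos_INR i).
    assert (Hi' : INR i <= Mreal m A) by (apply le_INR; lia).
    eapply Rle_trans; [apply Cmod_add|].
    rewrite Cmod_mul, Cmod_rad, Rmult_1_l.
    eapply Rle_trans; [apply Rplus_le_compat_r, Cmod_add|].
    eapply Rle_trans; [apply Rplus_le_compat_r, Rplus_le_compat_r, Cmod_add|].
    rewrite !Cmod_scal, Cmod_mul, !Rabs_pos_eq by lra. simpl fej_bound.
    specialize (IH i Hi).
    pose proof (Cmod_sum_dir A b x t Hx Ht ltac:(lia)) as K1.
    pose proof (Cmod_dir_mul A b x t Hx Ht ltac:(lia)) as K2.
    pose proof (Cmod_sum_rad A b x t) as K3.
    pose proof (Cmod_fej_Mk A x t Hx Ht) as K4.
    assert (Hc : 0 <= Mreal m A * cell A x t) by (pose proof (cell_nonneg A x t); nra).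
    assert (E1 : Mreal m A * Cmod (Csum b (fun s => dir (s * Mk m A) x t)) <=
            Mreal m A * (B ^ 2 * (Mreal m A * cell A x t))) by (apply Rmult_le_compat_l; lra).
    assert (E2 : Cmod (Csum b (fun s => rad A s x t)) * Cmod (fej (Mk m A) x t) <=
            B * fej_block_bound A x t) by (apply Rmult_le_compat; auto using Cmod_ge0; lra).
    (* Here [i <= M_A] and [b <= B <= B ^ 2], so the bound of [E1] serves again. *)
    assert (E3 : INR i * Cmod (dir (b * Mk m A) x t) <=
                 Mreal m A * (B ^ 2 * (Mreal m A * cell A x t))).
    { apply Rmult_le_compat; auto using Cmod_ge0.
      eapply Rle_trans; [exact K2|]. apply Rmult_le_compat_r; auto. nra. }
    lra.
Qed.

End Kernels.

(** * Powers and integrals of the kernel majorants *)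

Lemma rpow_Rpower t q : 0 < t -> rpow t q = Rpower t q.
Proof. intros H. unfold rpow. destruct (Rle_dec t 0); [lra|reflexivity]. Qed.

Lemma rpow_zero q : rpow 0 q = 0.
Proof. unfold rpow. destruct (Rle_dec 0 0); [reflexivity|lra]. Qed.

Lemma Rpower_pos t q : 0 < Rpower t q.
Proof. apply exp_pos. Qed.

Lemma rpow_nonneg t q : 0 <= rpow t q.
Proof. unfold rpow. destruct (Rle_dec t 0); [lra|]. apply Rlt_le, Rpower_pos. Qed.

Lemma rpow_le s t q : 0 < q -> s <= t -> rpow s q <= rpow t q.
Proof.
  intros Hq Hst. unfold rpow. destruct (Rle_dec s 0), (Rle_dec t 0); try lra.
  - apply Rlt_le, Rpower_pos.
  - apply Rle_Rpower_l; lra.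
Qed.

Lemma Rpower_lt_1 x q : 1 < x -> q < 0 -> Rpower x q < 1.
Proof.
  intros Hx Hq. apply Rlt_le_trans with (Rpower x 0).
  - now apply Rpower_lt.
  - rewrite Rpower_O; lra.
Qed.

Lemma Rpower_le_1 x q : 1 <= x -> q <= 0 -> Rpower x q <= 1.
Proof.
  intros Hx Hq. apply Rle_trans with (Rpower x 0).
  - now apply Rle_Rpower.
  - rewrite Rpower_O; lra.
Qed.

Lemma Rpower_mul a b q : 0 < a -> 0 < b -> Rpower (a * b) q = Rpower a q * Rpower b q.
Proof. intros Ha Hb. symmetry. now apply Rpower_mult_distr. Qed.

Lemma rpow_mul s t q : 0 <= s -> 0 <= t -> rpow (s * t) q = rpow s q * rpow t q.
Proof.
  intros [Hs|<-] [Ht|<-]; rewrite ?Rmult_0_l, ?Rmult_0_r, ?rpow_zero; try ring.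
  rewrite !rpow_Rpower by nra. now apply Rpower_mul.
Qed.

Lemma rpow_one q : rpow 1 q = 1.
Proof. rewrite rpow_Rpower by lra. unfold Rpower. now rewrite ln_1, Rmult_0_r, exp_0. Qed.

Lemma Rpower_ge_self u q : 0 < u < 1 -> 0 < q < 1 -> u <= Rpower u q.
Proof.
  intros Hu Hq. rewrite <- (exp_ln u) at 1 by lra. unfold Rpower.
  assert (ln u < 0) by (rewrite <- ln_1; apply ln_increasing; lra).
  apply Rlt_le, exp_increasing. nra.
Qed.

(** The inequality [u <= u ^ q] on [(0, 1)], applied to [s / (s + t)] and [t / (s + t)], whose sum
    is 1, then multiplied by [(s + t) ^ q]. *)
Lemma rpow_add s t q : 0 < q < 1 -> 0 <= s -> 0 <= t -> rpow (s + t) q <= rpow s q + rpow t q.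
Proof.
  intros Hq [Hs|<-] [Ht|<-]; rewrite ?Rplus_0_l, ?Rplus_0_r, ?rpow_zero; try lra.
  assert (Hf : forall a b, 0 < a -> 0 < b ->
           a / (a + b) * Rpower (a + b) q <= Rpower a q).
  { intros a b Ha Hb.
    assert (Hu : 0 < a / (a + b) < 1).
    { split; [apply Rdiv_lt_0_compat; lra|]. apply Rmult_lt_reg_r with (a + b); [lra|].
      unfold Rdiv. rewrite Rmult_assoc, Rinv_l; lra. }
    replace (Rpower a q) with (Rpower (a / (a + b)) q * Rpower (a + b) q).
    - apply Rmult_le_compat_r; [apply Rlt_le, Rpower_pos|now apply Rpower_ge_self].
    - rewrite <- Rpower_mul by lra. f_equal. field. lra. }
  rewrite !rpow_Rpower by lra.
  pose proof (Hf s t Hs Ht) as K1. pose proof (Hf t s Ht Hs) as K2.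
  rewrite (Rplus_comm t s) in K2.
  replace (Rpower (s + t) q)
    with (s / (s + t) * Rpower (s + t) q + t / (s + t) * Rpower (s + t) q)
    by (field; lra). lra.
Qed.

Lemma rpow_Rsum q n g : 0 < q < 1 -> (forall i, (i < n)%nat -> 0 <= g i) ->
  rpow (Rsum n g) q <= Rsum n (fun i => rpow (g i) q).
Proof.
  intros Hq. induction n as [|n IH]; intros H; simpl; [rewrite rpow_zero; lra|].
  eapply Rle_trans; [apply rpow_add; auto; apply Rsum_nonneg; auto|].
  apply Rplus_le_compat_r. auto.
Qed.

Lemma eqi_sym a b : eqi a b = eqi b a.
Proof. unfold eqi. now rewrite Nat.eqb_sym. Qed.

Lemma rpow_eqi a b q : rpow (eqi a b) q = eqi a b.
Proof. unfold eqi. destruct (Nat.eqb a b); [apply rpow_one|apply rpow_zero]. Qed.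

Section KernelIntegrals.
Context (m : nat -> nat) (hm : forall k, (2 <= m k)%nat).
Context (B : R) (hB : forall k, INR (m k) <= B).

Notation majM := (fej_block_bound m B).
Notation maj := (fej_bound m B).
Notation MR := (Mreal m).

Lemma cell_ext A x t x' t' : (forall k, (k < A)%nat -> x k = x' k) ->
  (forall k, (k < A)%nat -> t k = t' k) -> cell A x t = cell A x' t'.
Proof.
  induction A as [|A IH]; intros Hx Ht; simpl; [reflexivity|].
  rewrite (Hx A), (Ht A), IH; auto.
Qed.

Lemma majM_ext A x t x' t' : (forall k, (k < A)%nat -> x k = x' k) ->
  (forall k, (k < A)%nat -> t k = t' k) -> majM A x t = majM A x' t'.
Proof.
  induction A as [|A IH]; intros Hx Ht; simpl; [reflexivity|].
  rewrite (Hx A), (Ht A), IH, (cell_ext A x t x' t'); auto.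
Qed.

Lemma maj_ext A x t x' t' : (forall k, (k < A)%nat -> x k = x' k) ->
  (forall k, (k < A)%nat -> t k = t' k) -> maj A x t = maj A x' t'.
Proof.
  induction A as [|A IH]; intros Hx Ht; simpl; [reflexivity|].
  rewrite IH, (majM_ext A x t x' t'), (cell_ext A x t x' t'); auto.
Qed.

Lemma cell_fdep A x : fdep m A (cell A x).
Proof. intros t t' _ _ H. now apply cell_ext. Qed.

Lemma majM_fdep A x : fdep m A (majM A x).
Proof. intros t t' _ _ H. now apply majM_ext. Qed.

Lemma fdep_mul K A (g h : (nat -> nat) -> R) : (K <= A)%nat -> fdep m K h -> fdep m A g ->
  fdep m A (fun t => h t * g t).
Proof.
  intros HKA Hh Hg t t' Ht Ht' H. rewrite (Hg t t'), (Hh t t'); auto.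
  intros; apply H; lia.
Qed.

(** What remains of [fej_bound A], up to the factor [M_A / M_K], after averaging over cells of level
    [K]: the part from levels below [K], and two terms that collect all levels from [K] on. *)
Definition wker (K : nat) (x t : nat -> nat) : R :=
  maj K x t + B * majM K x t + 2 * B ^ 3 * MR K ^ 2 * cell K x t.

Lemma wker_nonneg K x t : 0 <= wker K x t.
Proof.
  unfold wker. pose proof (B_ge2 m hm B hB).
  pose proof (maj_nonneg m hm B hB K x t). pose proof (majM_nonneg m hm B hB K x t).
  pose proof (cell_nonneg K x t). pose proof (MR_pos m hm K).
  repeat apply Rplus_le_le_0_compat; repeat apply Rmult_le_pos; lra.
Qed.

Lemma wker_fdep K x : fdep m K (wker K x).
Proof.
  intros t t' _ _ H. unfold wker.
  rewrite (maj_ext K x t x t'), (majM_ext K x t x t'), (cell_ext K x t x t'); auto.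
Qed.

(** * Averages of the kernel majorants against a density of level [K] *)

Section Conditional.
Context (N K : nat) (h : (nat -> nat) -> R) (x : nat -> nat).
Context (h_ge0 : forall t, in_Gm m t -> 0 <= h t) (h_dep : fdep m K h) (Hx : in_Gm m x).

(** Since [h] depends only on the first [K] coordinates, each further condition [x A = t A] divides
    the integral by [m_A]. *)
Lemma integ_cell A : (K <= A <= N)%nat ->
  MR A * Rinteg m N (fun t => h t * cell A x t)
  = MR K * Rinteg m N (fun t => h t * cell K x t).
Proof.
  intros [HA HN]. revert HN. induction HA as [|A HA IH]; intros HN; [reflexivity|].
  rewrite <- IH by lia. clear IH. simpl cell.
  rewrite (Rinteg_ext m hm N _ (fun t => eqi (x A) (t A) * (h t * cell A x t)))
    by (intros; ring).
  rewrite (Rinteg_eqi m hm A); auto; [|apply (fdep_mul K); auto using cell_fdep].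
  rewrite MR_S. pose proof (m_ge2 m hm A). field. lra.
Qed.

Lemma integ_cell_ge0 A : 0 <= Rinteg m N (fun t => h t * cell A x t).
Proof.
  apply Rinteg_nonneg; auto. intros. apply Rmult_le_pos; auto using cell_nonneg.
Qed.

(** Averaging over coordinate [A] cancels the factor [m_A] of the recursion, so level [A] only adds
    [B ^ 2 * M_A * M_K] times the cell integral. As [M_A] at least doubles, the levels from [K] to
    [A - 1] add up to at most the last bound. *)
Lemma integ_majM A : (K <= A <= N)%nat ->
  Rinteg m N (fun t => h t * majM A x t)
  <= Rinteg m N (fun t => h t * majM K x t)
     + B ^ 2 * MR A * MR K * Rinteg m N (fun t => h t * cell K x t).
Proof.
  pose proof (integ_cell_ge0 K) as He. pose proof (B_ge2 m hm B hB).
  pose proof (MR_pos m hm K).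
  intros [HA HN]. revert HN. induction HA as [|A HA IH]; intros HN.
  - assert (0 <= B ^ 2 * MR K * MR K) by (repeat apply Rmult_le_pos; lra). nra.
  - specialize (IH ltac:(lia)). cbn [fej_block_bound].
    rewrite (Rinteg_ext m hm N _ (fun t => INR (m A) * (eqi (x A) (t A) * (h t * majM A x t))
        + B ^ 2 * MR A ^ 2 * (h t * cell A x t))) by (intros; ring).
    rewrite Rinteg_plus, !Rinteg_scal.
    rewrite (Rinteg_eqi m hm A); auto; [|apply (fdep_mul K); auto using majM_fdep].
    pose proof (integ_cell A ltac:(lia)) as Hc. pose proof (m_ge2 m hm A).
    rewrite <- Rmult_assoc, Rinv_r, Rmult_1_l by lra.
    replace (B ^ 2 * MR A ^ 2 * Rinteg m N (fun t => h t * cell A x t))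
      with (B ^ 2 * MR A * (MR A * Rinteg m N (fun t => h t * cell A x t))) by ring.
    rewrite Hc. pose proof (MR_double m hm A).
    set (e := Rinteg m N (fun t => h t * cell K x t)) in *.
    clearbody e. assert (HX : 0 <= B ^ 2 * MR K * e) by (repeat apply Rmult_le_pos; lra).
    assert (2 * MR A * (B ^ 2 * MR K * e) <= MR (S A) * (B ^ 2 * MR K * e))
      by (apply Rmult_le_compat_r; auto).
    lra.
Qed.

(** The increment of level [A], multiplied by [M_K], is at most [M_A] times the integral against
    [wker K]; doubling of [M_A] then closes the induction. *)
Lemma integ_maj A : (K <= A <= N)%nat ->
  MR K * Rinteg m N (fun t => h t * maj A x t)
  <= MR A * Rinteg m N (fun t => h t * wker K x t).
Proof.
  pose proof (integ_cell_ge0 K) as He. pose proof (B_ge2 m hm B hB).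
  pose proof (MR_pos m hm K).
  set (e := Rinteg m N (fun t => h t * cell K x t)) in *.
  set (g := Rinteg m N (fun t => h t * majM K x t)).
  set (d := Rinteg m N (fun t => h t * maj K x t)).
  assert (Hg : 0 <= g).
  { apply Rinteg_nonneg; auto. intros. apply Rmult_le_pos; auto.
    apply (majM_nonneg m hm B hB). }
  assert (Hd : 0 <= d).
  { apply Rinteg_nonneg; auto. intros. apply Rmult_le_pos; auto.
    apply (maj_nonneg m hm B hB). }
  assert (Hw : Rinteg m N (fun t => h t * wker K x t)
               = d + B * g + 2 * B ^ 3 * MR K ^ 2 * e).
  { unfold wker, d, g, e. rewrite <- !Rinteg_scal, <- !Rinteg_plus.
    apply Rinteg_ext; auto. intros; ring. }
  rewrite Hw. clear Hw.
  assert (Hb3 : 0 <= B ^ 3 * e) by (apply Rmult_le_pos; auto; apply pow_le; lra).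
  intros [HA HN]. revert HN. induction HA as [|A HA IH]; intros HN.
  - fold d. apply Rmult_le_compat_l; [lra|].
    assert (0 <= B ^ 3 * e * MR K ^ 2) by (apply Rmult_le_pos; [auto|apply pow2_ge_0]).
    nra.
  - specialize (IH ltac:(lia)). cbn [fej_bound].
    rewrite (Rinteg_ext m hm N _ (fun t => h t * maj A x t + B * (h t * majM A x t)
        + 2 * B ^ 2 * MR A * (MR A * (h t * cell A x t)))) by (intros; ring).
    rewrite !Rinteg_plus, !Rinteg_scal, (integ_cell A) by lia. fold e.
    pose proof (integ_majM A ltac:(lia)) as HM. fold e g in HM. clearbody e g d.
    pose proof (MR_double m hm A). pose proof (MR_le m hm K A HA).
    set (w := d + B * g + 2 * B ^ 3 * MR K ^ 2 * e) in *.
    assert (Hw : 0 <= w).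
    { assert (0 <= B ^ 3 * e * MR K ^ 2) by (apply Rmult_le_pos; [auto|apply pow2_ge_0]).
      unfold w. nra. }
    assert (HM' : B * Rinteg m N (fun t => h t * majM A x t)
              <= B * g + B ^ 3 * MR A * MR K * e).
    { replace (B * g + B ^ 3 * MR A * MR K * e) with (B * (g + B ^ 2 * MR A * MR K * e))
        by ring. apply Rmult_le_compat_l; lra. }
    (* As [2 <= B], the cell term has the size of the last term of [HM']; together they account for
       the coefficient [2 * B ^ 3] in [wker]. *)
    assert (HB3 : 2 * B ^ 2 * MR A * (MR K * e) <= B ^ 3 * MR A * MR K * e).
    { replace (2 * B ^ 2 * MR A * (MR K * e)) with (2 * (B ^ 2 * (MR A * MR K * e))) by ring.
      replace (B ^ 3 * MR A * MR K * e) with (B * (B ^ 2 * (MR A * MR K * e))) by ring.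
      apply Rmult_le_compat_r; [|lra]. repeat apply Rmult_le_pos; lra. }
    apply Rle_trans with (MR A * w + MR K * (B * g + 2 * B ^ 3 * MR A * MR K * e)); [nra|].
    apply Rle_trans with (MR A * w + MR A * w); [|nra].
    apply Rplus_le_compat_l. unfold w.
    assert (MR K * (B * g) <= MR A * (B * g)) by (apply Rmult_le_compat_r; nra).
    nra.
Qed.

End Conditional.

(** The averages above integrate in [t], the power integrals below in [x]; by symmetry the same
    dependence lemmas serve both. *)
Lemma cell_sym A x t : cell A x t = cell A t x.
Proof. induction A as [|A IH]; simpl; [reflexivity|]. now rewrite eqi_sym, IH. Qed.

Lemma majM_sym A x t : majM A x t = majM A t x.
Proof. induction A as [|A IH]; simpl; [reflexivity|]. now rewrite eqi_sym, IH, cell_sym. Qed.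

Lemma maj_sym A x t : maj A x t = maj A t x.
Proof. induction A as [|A IH]; simpl; [reflexivity|]. now rewrite IH, majM_sym, cell_sym. Qed.

Lemma wker_sym A x t : wker A x t = wker A t x.
Proof. unfold wker. now rewrite maj_sym, majM_sym, cell_sym. Qed.

Lemma rpow_cell A x t q : rpow (cell A x t) q = cell A x t.
Proof.
  induction A as [|A IH]; simpl; [apply rpow_one|].
  rewrite rpow_mul, rpow_eqi, IH; auto using eqi_nonneg, cell_nonneg.
Qed.

(** * Integrals of [p]-th powers of the kernel majorants *)

Section PowerIntegrals.
Context (p : R) (hp : 0 < p < 1 / 2).

Lemma integ_one_cell N A t : in_Gm m t -> (A <= N)%nat ->
  MR A * Rinteg m N (cell A t) = 1.
Proof.
  intros Ht HA.
  rewrite (Rinteg_ext m hm N _ (fun x => 1 * cell A t x)) by (intros; ring).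
  rewrite (integ_cell N 0 (fun _ => 1) t); [|..|lia]; auto.
  - rewrite Rinteg_scal. simpl cell. rewrite Rinteg_const by auto. unfold Mreal; simpl; ring.
  - intros ? ? ? ? ?; reflexivity.
Qed.

Lemma Rpower_MR_sq A : rpow (MR A ^ 2) p * / MR A = Rpower (MR A) (2 * p - 1).
Proof.
  pose proof (MR_pos m hm A).
  rewrite rpow_Rpower by nra. replace (MR A ^ 2) with (MR A * MR A) by ring.
  rewrite Rpower_mul by auto. rewrite <- (Rpower_1 (MR A)) at 3 by auto.
  rewrite <- Rpower_Ropp, <- !Rpower_plus. f_equal. ring.
Qed.

(** A height [a * M_A ^ 2] on a cell of measure [1 / M_A]. The exponent [2p - 1] is negative exactly
    because [p < 1/2]. *)
Lemma integ_cell_term N A t a : in_Gm m t -> (A <= N)%nat -> 0 <= a ->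
  Rinteg m N (fun x => rpow (a * MR A ^ 2 * cell A t x) p)
  = rpow a p * Rpower (MR A) (2 * p - 1).
Proof.
  intros Ht HA Ha. pose proof (MR_pos m hm A).
  rewrite <- Rpower_MR_sq, <- Rmult_assoc.
  rewrite (Rinteg_ext m hm N _ (fun x => rpow a p * rpow (MR A ^ 2) p * cell A t x)).
  - rewrite Rinteg_scal. pose proof (integ_one_cell N A t Ht HA) as E.
    replace (Rinteg m N (cell A t)) with (/ MR A); [ring|].
    apply Rmult_eq_reg_l with (MR A); [rewrite Rinv_r|]; lra.
  - intros x Hx. rewrite !rpow_mul, rpow_cell; try ring;
    pose proof (cell_nonneg A t x); repeat apply Rmult_le_pos; lra.
Qed.

(** The integrals [I_A] satisfy [I_(A+1) <= m_A ^ (p-1) * I_A + b * M_A ^ (2p-1)]. A bound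
    [c * M_A ^ (2p-1)] passes to the next level as soon as
    [b <= c * m_A ^ (p-1) * (m_A ^ p - 1)]. *)
Lemma integ_majM_pow : exists c, 0 < c /\ forall N A t, in_Gm m t -> (A <= N)%nat ->
  Rinteg m N (fun x => rpow (majM A t x) p) <= c * Rpower (MR A) (2 * p - 1).
Proof.
  pose proof (B_ge2 m hm B hB) as HB.
  set (b := rpow (B ^ 2) p).
  assert (Hb : 0 < b) by (unfold b; rewrite rpow_Rpower by nra; apply Rpower_pos).
  assert (H2 : 1 < Rpower 2 p).
  { rewrite <- (Rpower_O 2) by lra. apply Rpower_lt; lra. }
  pose proof (Rpower_pos B (p - 1)) as Hr.
  (* A lower bound of [m_A ^ (p-1) * (m_A ^ p - 1)] for [2 <= m_A <= B]; so [c = b / d] works. *)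
  set (d := Rpower B (p - 1) * (Rpower 2 p - 1)).
  assert (Hd : 0 < d) by (apply Rmult_lt_0_compat; lra).
  exists (b / d). assert (Hc : 0 < b / d) by (apply Rdiv_lt_0_compat; auto).
  split; auto. intros N A t Ht. induction A as [|A IH]; intros HA.
  - simpl. rewrite rpow_zero, Rinteg_const by auto.
    apply Rlt_le, Rmult_lt_0_compat; auto using Rpower_pos.
  - specialize (IH ltac:(lia)). pose proof (MR_pos m hm A) as HMA.
    pose proof (m_ge2 m hm A) as Hm. pose proof (hB A) as HmB.
    set (P := Rpower (MR A) (2 * p - 1)) in *.
    assert (HP : 0 < P) by apply Rpower_pos.
    apply Rle_trans with
      (Rinteg m N (fun x => rpow (INR (m A)) p * (eqi (t A) (x A) * rpow (majM A t x) p)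
         + rpow (B ^ 2 * MR A ^ 2 * cell A t x) p)).
    + apply Rinteg_le; auto. intros x Hx. cbn [fej_block_bound].
      pose proof (majM_nonneg m hm B hB A t x). pose proof (eqi_nonneg (t A) (x A)).
      pose proof (cell_nonneg A t x).
      eapply Rle_trans; [apply rpow_add|]; try lra.
      * repeat apply Rmult_le_pos; lra.
      * repeat apply Rmult_le_pos; lra.
      * rewrite (rpow_mul (INR (m A) * _)), rpow_mul, rpow_eqi; try lra.
        repeat apply Rmult_le_pos; lra.
    + rewrite Rinteg_plus, Rinteg_scal, integ_cell_term; auto; try lia; [|nra].
      rewrite (Rinteg_eqi m hm A); auto.
      2: { intros x y Hx Hy H. f_equal. now apply majM_ext. }
      fold b P.
      assert (Hm1 : rpow (INR (m A)) p * / INR (m A) = Rpower (INR (m A)) (p - 1)).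
      { rewrite rpow_Rpower by lra. rewrite <- (Rpower_1 (INR (m A))) at 2 by lra.
        rewrite <- Rpower_Ropp, <- Rpower_plus. f_equal. }
      rewrite <- Rmult_assoc, Hm1, MR_S, Rpower_mul by lra. fold P.
      assert (Hm2 : Rpower (INR (m A)) (2 * p - 1) =
                    Rpower (INR (m A)) (p - 1) * Rpower (INR (m A)) p).
      { rewrite <- Rpower_plus. f_equal. ring. }
      rewrite Hm2.
      assert (Hlo : Rpower 2 p <= Rpower (INR (m A)) p) by (apply Rle_Rpower_l; lra).
      assert (Hlo' : Rpower B (p - 1) <= Rpower (INR (m A)) (p - 1)).
      { replace (p - 1) with (- (1 - p)) by ring. rewrite !Rpower_Ropp.
        apply Rinv_le_contravar; [apply Rpower_pos|]. apply Rle_Rpower_l; lra. }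
      set (u := Rpower (INR (m A)) (p - 1)) in *. set (v := Rpower (INR (m A)) p) in *.
      assert (Hdd : d <= u * (v - 1)) by (unfold d; apply Rmult_le_compat; lra).
      assert (Hbd : b <= b / d * (u * (v - 1))).
      { replace b with (b / d * d) at 1 by (field; lra).
        apply Rmult_le_compat_l; lra. }
      apply Rle_trans with (u * (b / d * P) + b * P).
      * apply Rplus_le_compat_r, Rmult_le_compat_l; [unfold u; apply Rlt_le, Rpower_pos|auto].
      * replace (u * (b / d * P) + b * P) with ((u * (b / d) + b) * P) by ring.
        replace (b / d * (u * v * P)) with ((b / d * (u * v)) * P) by ring.
        apply Rmult_le_compat_r; lra.
Qed.

Lemma Rsum_geom q n : 0 < q < 1 -> Rsum n (fun i => q ^ i) <= / (1 - q).
Proof.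
  intros Hq. assert (E : (1 - q) * Rsum n (fun i => q ^ i) = 1 - q ^ n).
  { induction n as [|n IH]; simpl; [ring|]. rewrite Rmult_plus_distr_l, IH. ring. }
  apply Rmult_le_reg_l with (1 - q); [lra|]. rewrite E, Rinv_r by lra.
  pose proof (pow_le q n). lra.
Qed.

(** [M_a >= 2 ^ a] and the exponent is negative, so a geometric series dominates. *)
Lemma sum_MR_pow A :
  Rsum A (fun a => Rpower (MR a) (2 * p - 1)) <= / (1 - Rpower 2 (2 * p - 1)).
Proof.
  assert (Hq : 0 < Rpower 2 (2 * p - 1) < 1).
  { split; [apply Rpower_pos|apply Rpower_lt_1; lra]. }
  eapply Rle_trans; [|apply Rsum_geom; exact Hq]. apply Rsum_le. intros a _.
  rewrite <- Rpower_pow, Rpower_mult, (Rmult_comm _ (INR a)), <- Rpower_mult by lra.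
  rewrite Rpower_pow by lra.
  replace (2 * p - 1) with (- (1 - 2 * p)) by ring. rewrite !Rpower_Ropp.
  apply Rinv_le_contravar; [apply Rpower_pos|]. apply Rle_Rpower_l; [lra|].
  split; [apply pow_lt; lra|]. induction a as [|a IH]; [unfold Mreal; simpl; lra|].
  simpl pow. pose proof (MR_double m hm a). lra.
Qed.

(** By subadditivity, level [a] contributes a multiple of [M_a ^ (2p-1)] to the integral for
    [fej_bound], and these are summable; the other two terms of [wker] involve the single level
    [K]. *)
Lemma integ_wker_pow : exists c, 0 < c /\ forall N K t, in_Gm m t -> (K <= N)%nat ->
  Rinteg m N (fun x => rpow (wker K x t) p) <= c.
Proof.
  pose proof (B_ge2 m hm B hB) as HB. destruct integ_majM_pow as [c [Hc HcM]].
  set (b1 := rpow B p). set (b2 := rpow (2 * B ^ 2) p). set (b3 := rpow (2 * B ^ 3) p).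
  assert (Hb1 : 0 <= b1) by apply rpow_nonneg. assert (Hb2 : 0 <= b2) by apply rpow_nonneg.
  assert (Hb3 : 0 <= b3) by apply rpow_nonneg.
  assert (HB3 : 0 <= B ^ 3) by (apply pow_le; lra).
  assert (HMp : forall A, Rpower (MR A) (2 * p - 1) <= 1).
  { intros A. pose proof (MR_ge1 m hm A). apply Rpower_le_1; lra. }
  assert (HM1 : forall N A t, in_Gm m t -> (A <= N)%nat ->
    Rinteg m N (fun x => rpow (B * majM A t x) p) <= b1 * c * Rpower (MR A) (2 * p - 1)).
  { intros N A t Ht HA. rewrite (Rinteg_ext m hm N _ (fun x => b1 * rpow (majM A t x) p)).
    - rewrite Rinteg_scal, Rmult_assoc. apply Rmult_le_compat_l; auto.
    - intros x Hx. apply rpow_mul; [lra|apply (majM_nonneg m hm B hB)]. }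
  assert (Hj : forall N A t, in_Gm m t -> (A <= N)%nat ->
    Rinteg m N (fun x => rpow (maj A t x) p)
    <= (b1 * c + b2) * Rsum A (fun a => Rpower (MR a) (2 * p - 1))).
  { intros N A t Ht. induction A as [|A IH]; intros HA.
    - simpl. rewrite rpow_zero, Rinteg_const by auto. lra.
    - specialize (IH ltac:(lia)). specialize (HM1 N A t Ht ltac:(lia)).
      pose proof (integ_cell_term N A t (2 * B ^ 2) Ht ltac:(lia) ltac:(nra)) as HC.
      fold b2 in HC. simpl Rsum. rewrite Rmult_plus_distr_l.
      apply Rle_trans with (Rinteg m N (fun x => rpow (maj A t x) p)
        + Rinteg m N (fun x => rpow (B * majM A t x) p)
        + Rinteg m N (fun x => rpow (2 * B ^ 2 * MR A ^ 2 * cell A t x) p)); [|lra].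
      rewrite <- !Rinteg_plus. apply Rinteg_le; auto. intros x Hx. cbn [fej_bound].
      pose proof (maj_nonneg m hm B hB A t x). pose proof (majM_nonneg m hm B hB A t x).
      pose proof (cell_nonneg A t x). pose proof (MR_pos m hm A).
      assert (0 <= B * majM A t x) by nra.
      eapply Rle_trans; [apply rpow_add|apply Rplus_le_compat_r, rpow_add]; try lra.
      repeat apply Rmult_le_pos; lra. }
  assert (Hq : 0 < / (1 - Rpower 2 (2 * p - 1))).
  { apply Rinv_0_lt_compat. assert (Rpower 2 (2 * p - 1) < 1) by (apply Rpower_lt_1; lra). lra. }
  assert (Hbc : 0 <= b1 * c) by nra.
  exists ((b1 * c + b2) * / (1 - Rpower 2 (2 * p - 1)) + b1 * c + b3 + 1).
  split; [nra|]. intros N K t Ht HK.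
  specialize (HM1 N K t Ht HK). specialize (Hj N K t Ht HK). specialize (HMp K).
  pose proof (integ_cell_term N K t (2 * B ^ 3) Ht HK ltac:(lra)) as HC. fold b3 in HC.
  apply Rle_trans with (Rinteg m N (fun x => rpow (maj K t x) p)
        + Rinteg m N (fun x => rpow (B * majM K t x) p)
        + Rinteg m N (fun x => rpow (2 * B ^ 3 * MR K ^ 2 * cell K t x) p)).
  - rewrite <- !Rinteg_plus. apply Rinteg_le; auto. intros x Hx. rewrite wker_sym. unfold wker.
    pose proof (maj_nonneg m hm B hB K t x). pose proof (majM_nonneg m hm B hB K t x).
    pose proof (cell_nonneg K t x). pose proof (MR_pos m hm K).
    assert (0 <= B * majM K t x) by nra.
    eapply Rle_trans; [apply rpow_add|apply Rplus_le_compat_r, rpow_add]; try lra.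
    repeat apply Rmult_le_pos; lra.
  - rewrite HC.
    assert ((b1 * c + b2) * Rsum K (fun a => Rpower (MR a) (2 * p - 1))
            <= (b1 * c + b2) * / (1 - Rpower 2 (2 * p - 1))).
    { apply Rmult_le_compat_l; [lra|apply sum_MR_pow]. }
    nra.
Qed.

End PowerIntegrals.
End KernelIntegrals.

(** * Principal cells and the maximal operator *)

Lemma Rmax_from_ge a len g k : (k <= len)%nat -> g (a + k)%nat <= Rmax_from a len g.
Proof.
  induction len as [|len IH]; intros Hk; simpl.
  - replace k with 0%nat by lia. rewrite Nat.add_0_r. lra.
  - destruct (Nat.eq_dec k (S len)) as [->|Hne]; [apply Rmax_r|].
    eapply Rle_trans; [apply IH; lia|apply Rmax_l].
Qed.

Lemma Rmax_from_attained a len g : exists k, (k <= len)%nat /\ Rmax_from a len g = g (a + k)%nat.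
Proof.
  induction len as [|len [k [Hk IH]]]; simpl.
  - exists 0%nat. now rewrite Nat.add_0_r.
  - destruct (Rle_dec (Rmax_from a len g) (g (a + S len)%nat)).
    + exists (S len). split; auto. now apply Rmax_right.
    + exists k. split; [lia|]. rewrite <- IH. apply Rmax_left. lra.
Qed.

Lemma Rmax_from_ext a len g h : (forall k, (k <= len)%nat -> g (a + k)%nat = h (a + k)%nat) ->
  Rmax_from a len g = Rmax_from a len h.
Proof.
  induction len as [|len IH]; intros H; simpl.
  - specialize (H 0%nat (le_n _)). now rewrite Nat.add_0_r in H.
  - rewrite IH, H; auto.
Qed.

(** [Rlim] selects some limit by [epsilon]; uniqueness of limits identifies it. *)
Lemma Rlim_eventually u l n0 : (forall n, (n0 <= n)%nat -> u n = l) -> Rlim u = l.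
Proof.
  intros H. assert (Hu : Un_cv u l).
  { intros eps Heps. exists n0. intros n Hn. rewrite H by auto.
    unfold Rdist. rewrite Rminus_diag, Rabs_R0. lra. }
  apply (UL_sequence u); auto. unfold Rlim. apply epsilon_spec. now exists l.
Qed.

(** * Fejer means of a martingale as integrals against the kernel *)

Section Fejer.
Context (m : nat -> nat) (hm : forall k, (2 <= m k)%nat).
Context (B : R) (hB : forall k, INR (m k) <= B).
Context (f : nat -> (nat -> nat) -> Cx) (hf : is_martingale m f).

Notation fej := (fej m).
Notation MR := (Mreal m).

Lemma mart_fdep n : fdep m n (f n).
Proof. exact (proj1 hf n). Qed.

Lemma mart_step n x : in_Gm m x ->
  f n x = Cscal (/ INR (m n)) (Csum (m n) (fun j => f (S n) (upd x n j))).
Proof. exact (proj2 hf n x). Qed.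

Lemma fcoef_integ_fdep i k : (i <= k)%nat ->
  fdep m k (fun x => Cmul (f k x) (Cconj (psi m i x))).
Proof.
  intros Hi x y Hx Hy H. rewrite (mart_fdep k x y) by auto.
  rewrite (psi_fdep m hm k i) with (y := y); auto.
  pose proof (Mk_gt m hm k). lia.
Qed.

(** The integrals defining the coefficient are constant from [k = i] on: since [i <= k < M_k],
    averaging over coordinate [k] acts on [f] alone, where it is the martingale property. *)
Lemma fcoef_integ i N : (i <= N)%nat ->
  fcoef m f i = Cinteg m N (fun x => Cmul (f N x) (Cconj (psi m i x))).
Proof.
  intros HN.
  set (v := fun k => Cinteg m k (fun x => Cmul (f k x) (Cconj (psi m i x)))).
  assert (Hv : forall k, (i <= k)%nat -> v k = v i).
  { intros k Hk. induction Hk as [|k Hk IH]; [reflexivity|]. rewrite <- IH. unfold v.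
    rewrite Cinteg_S by auto. apply Cinteg_ext; auto. intros x Hx.
    rewrite (mart_step k x Hx).
    rewrite (Csum_ext _ _ (fun q => Cmul (f (S k) (upd x k q)) (Cconj (psi m i x)))).
    - rewrite Csum_mul_r, !Cscal_mul. ring.
    - intros q Hq. f_equal. f_equal. apply (fdep_cond m k); auto.
      apply psi_fdep; auto. pose proof (Mk_gt m hm k). lia. }
  change (Cinteg m N _) with (v N). rewrite (Hv N) by auto.
  assert (Hu : forall k, (i <= k)%nat ->
    Cinteg m (k + i) (fun x => Cmul (f k x) (Cconj (psi m i x))) = v i).
  { intros k Hk. rewrite <- (Hv k) by auto. apply Cinteg_dep; auto; [|lia].
    now apply fcoef_integ_fdep. }
  unfold fcoef, Clim. apply Cx_eq; cbn [fst snd]; apply (Rlim_eventually _ _ i);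
    intros k Hk; now rewrite Hu.
Qed.

(** Only coefficients of index below [n <= N] enter, and all of them can be read off [f N]. *)
Lemma fejer_integ n N x : (n <= N)%nat ->
  fejer m f n x = Cscal (/ INR n) (Cinteg m N (fun t => Cmul (f N t) (fej n x t))).
Proof.
  intros Hn. unfold fejer. f_equal.
  assert (HS : forall k, (k <= n)%nat ->
    Spart m f k x = Cinteg m N (fun t => Cmul (f N t) (dir m k x t))).
  { intros k Hk. unfold Spart, dir.
    rewrite (Cinteg_ext m hm N _ (fun t => Csum k (fun i => Cmul (f N t) (chi m i x t))))
      by (intros; now rewrite Csum_mul_l).
    rewrite (Cinteg_sum m N k (fun i t => Cmul (f N t) (chi m i x t))).
    apply Csum_ext. intros i Hi. rewrite (fcoef_integ i N) by lia.
    transitivity (Cmul (psi m i x)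
                    (Cinteg m N (fun t => Cmul (f N t) (Cconj (psi m i t))))); [ring|].
    rewrite <- Cinteg_mul_l. apply Cinteg_ext; auto. intros t _. unfold chi. ring. }
  rewrite (Csum_ext n _ (fun k => Cinteg m N (fun t => Cmul (f N t) (dir m k x t))))
    by (intros; apply HS; lia).
  rewrite <- Cinteg_sum. apply Cinteg_ext; auto. intros t _. apply Csum_mul_l.
Qed.

Lemma fej_fdep A n x : (n <= Mk m A)%nat -> fdep m A (fej n x).
Proof.
  intros Hn t t' Ht Ht' H. apply Csum_ext. intros k Hk. apply Csum_ext. intros i Hi.
  unfold chi. f_equal. f_equal. apply (psi_fdep m hm A i); auto. lia.
Qed.

(** * Principal cells and the decomposition of the martingale *)

Definition lam (K : nat) (t : nat -> nat) : R :=
  Rmax_from 0 (m K - 1) (fun q => Cmod (f (S K) (upd t K q))).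

Lemma lam_ge K t q : (q < m K)%nat -> Cmod (f (S K) (upd t K q)) <= lam K t.
Proof. intros Hq. apply (Rmax_from_ge 0 _ (fun q => Cmod (f (S K) (upd t K q)))). lia. Qed.

Lemma upd_id (t : nat -> nat) K : upd t K (t K) = t.
Proof.
  extensionality k. unfold upd. destruct (Nat.eqb_spec k K); subst; reflexivity.
Qed.

Lemma lam_ge_next K t : in_Gm m t -> Cmod (f (S K) t) <= lam K t.
Proof. intros Ht. rewrite <- (upd_id t K) at 1. now apply lam_ge. Qed.

Lemma lam_attained K t : exists q, (q < m K)%nat /\ lam K t = Cmod (f (S K) (upd t K q)).
Proof.
  destruct (Rmax_from_attained 0 (m K - 1) (fun q => Cmod (f (S K) (upd t K q))))
    as [q [Hq E]].
  exists q. split; auto. specialize (hm K). lia.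
Qed.

Lemma lam_nonneg K t : 0 <= lam K t.
Proof. destruct (lam_attained K t) as [q [_ ->]]. apply Cmod_ge0. Qed.

(** [f K] is the average of [f (S K)] over the children of a cell. *)
Lemma lam_ge_self K t : in_Gm m t -> Cmod (f K t) <= lam K t.
Proof.
  intros Ht. rewrite (mart_step K t Ht), Cmod_scal. pose proof (m_ge2 m hm K) as Hm.
  assert (0 < / INR (m K)) by (apply Rinv_0_lt_compat; lra).
  rewrite Rabs_pos_eq by lra.
  apply Rmult_le_reg_l with (INR (m K)); [lra|].
  rewrite <- Rmult_assoc, Rinv_r, Rmult_1_l, <- Rsum_const by lra.
  eapply Rle_trans; [apply Cmod_Csum|]. apply Rsum_le. intros; now apply lam_ge.
Qed.

Lemma upd_agree (t t' : nat -> nat) K q k :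
  (forall k, (k < K)%nat -> t k = t' k) -> (k < S K)%nat -> upd t K q k = upd t' K q k.
Proof.
  intros H Hk. unfold upd. destruct (Nat.eqb_spec k K); auto. apply H. lia.
Qed.

(** Taking the maximum over all children makes [lam] predictable: it bounds [f (S K)] while being
    known at level [K], so [pri] can stop before a large jump. *)
Lemma lam_fdep K : fdep m K (lam K).
Proof.
  intros t t' Ht Ht' H. apply Rmax_from_ext. intros q Hq. specialize (hm K).
  f_equal. apply mart_fdep; try apply in_Gm_upd; auto; try lia.
  intros k Hk. now apply upd_agree.
Qed.

(* The cell of level [pri l t] around [t] is the smallest principal cell of level
   at most [l]: a cell is principal when [lam] more than doubles on it. *)
Fixpoint pri (l : nat) (t : nat -> nat) : nat :=
  match l with
  | O => O
  | S l' => if Rlt_dec (2 * lam (pri l' t) t) (lam (S l') t) then S l' else pri l' t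
  end.

Lemma pri_le l t : (pri l t <= l)%nat.
Proof. induction l as [|l IH]; simpl; [lia|]. destruct Rlt_dec; lia. Qed.

Lemma pri_fdep l : fdep m l (pri l).
Proof.
  induction l as [|l IH]; intros t t' Ht Ht' H; [reflexivity|]. simpl.
  rewrite (IH t t'), (lam_fdep (S l) t t') by auto.
  rewrite (lam_fdep (pri l t') t t'); auto.
  intros k Hk. apply H. pose proof (pri_le l t'). lia.
Qed.

(** [pri] changes only by jumping to the current level, so a smaller value was already there one
    level before. *)
Lemma pri_prev l t K : pri (S l) t = K -> (K <= l)%nat -> pri l t = K.
Proof. simpl. destruct Rlt_dec; intros; lia. Qed.

Lemma pri_self l t K : pri l t = K -> pri K t = K.
Proof.
  intros H. assert (HK : (K <= l)%nat) by (rewrite <- H; apply pri_le).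
  revert H. induction HK as [|l HK IH]; auto. intros H. apply IH. now apply pri_prev.
Qed.

(** Either [l] is itself principal around [t], or the doubling test failed at [l]. *)
Lemma lam_le_pri l t : lam l t <= 2 * lam (pri l t) t.
Proof.
  destruct l as [|l]; simpl.
  - pose proof (lam_nonneg 0 t). lra.
  - destruct Rlt_dec; [|lra]. pose proof (lam_nonneg (S l) t). lra.
Qed.

Definition incr (K l : nat) (t : nat -> nat) : Cx :=
  if Nat.eqb (pri l t) K then Cadd (f (S l) t) (Copp (f l t)) else C0.

Definition piece (N K : nat) (t : nat -> nat) : Cx :=
  Cadd (Csum N (fun l => incr K l t)) (if Nat.eqb K 0 then f 0 t else C0).

(** The bound for [piece]: [2 lam K] for the last value of [f] reached, [lam K] for the subtracted
    [f K], and one more [lam K] for [f 0] when [K = 0]. The indicator says that the cell is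
    principal. *)
Definition height (K : nat) (t : nat -> nat) : R := 4 * lam K t * eqi (pri K t) K.

Lemma height_nonneg K t : 0 <= height K t.
Proof.
  unfold height. pose proof (lam_nonneg K t). pose proof (eqi_nonneg (pri K t) K). nra.
Qed.

Lemma height_fdep K : fdep m K (height K).
Proof.
  intros t t' Ht Ht' H. unfold height.
  now rewrite (lam_fdep K t t'), (pri_fdep K t t').
Qed.

(** Each increment of level [l < N] belongs to exactly one piece, as [pri l t <= l]; the increments
    telescope to [f N - f 0], and piece 0 restores [f 0]. *)
Lemma sum_piece N t : (1 <= N)%nat -> Csum N (fun K => piece N K t) = f N t.
Proof.
  intros HN. unfold piece. rewrite Csum_plus, Csum_swap.
  rewrite (Csum_single N 0 (fun K => if Nat.eqb K 0 then f 0 t else C0)); [|lia|].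
  2: { intros i _ Hi. now destruct i. }
  rewrite (Csum_ext N _ (fun l => Cadd (f (S l) t) (Copp (f l t)))).
  - clear HN. simpl. induction N as [|N IH]; simpl; [ring|].
    transitivity (Cadd (Cadd (Csum N (fun l => Cadd (f (S l) t) (Copp (f l t)))) (f 0%nat t))
                       (Cadd (f (S N) t) (Copp (f N t)))); [ring|].
    rewrite IH. ring.
  - intros l Hl. pose proof (pri_le l t).
    rewrite (Csum_single N (pri l t)); unfold incr; [now rewrite Nat.eqb_refl|lia|].
    intros i _ Hi. destruct (Nat.eqb_spec (pri l t) i); congruence.
Qed.

Lemma Cmod_piece N K t : in_Gm m t -> Cmod (piece N K t) <= height K t.
Proof.
  intros Ht. unfold piece, height, eqi. pose proof (lam_nonneg K t) as Hl.
  assert (Hlow : forall l, (l < K)%nat -> incr K l t = C0).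
  { intros l Hlk. unfold incr. pose proof (pri_le l t).
    destruct (Nat.eqb_spec (pri l t) K); [lia|reflexivity]. }
  destruct (Nat.eqb_spec (pri K t) K) as [HK|HK].
  - assert (HS : Cmod (Csum N (fun l => incr K l t)) <= 3 * lam K t).
    { destruct (Nat.le_ge_cases N K) as [HN|HN].
      - rewrite Csum_zero by (intros; apply Hlow; lia). rewrite Cmod_zero. lra.
      (* While [pri] equals [K] the increments telescope; once [pri] has left [K] it never returns,
         and the sum stays at its last value. *)
      - assert (H : Cmod (Csum N (fun l => incr K l t)) <= 3 * lam K t /\
                    (pri N t = K -> Csum N (fun l => incr K l t) = Cadd (f N t) (Copp (f K t)))).
        { induction HN as [|L HL IH].
          - rewrite Csum_zero by auto. rewrite Cmod_zero. split; [lra|]. intros; ring.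
          - destruct IH as [IH1 IH2]. cbn [Csum]. unfold incr at 2 4.
            destruct (Nat.eqb_spec (pri L t) K) as [HLK|HLK].
            + rewrite (IH2 HLK).
              replace (Cadd (Cadd (f L t) (Copp (f K t))) (Cadd (f (S L) t) (Copp (f L t))))
                with (Cadd (f (S L) t) (Copp (f K t))) by ring.
              (* [|f (S L)| <= lam L <= 2 lam K] holds even if [S L] opens a new principal cell,
                 because [lam L] already covers level [S L]. *)
              split; auto. eapply Rle_trans; [apply Cmod_add|]. rewrite Cmod_opp.
              pose proof (lam_ge_next L t Ht). pose proof (lam_ge_self K t Ht).
              pose proof (lam_le_pri L t). rewrite HLK in *. lra.
            + split.
              * replace (Cadd _ C0) with (Csum L (fun l => incr K l t)) by ring. auto.
              * intros E. apply pri_prev in E; [congruence|auto]. }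
        apply H. }
    eapply Rle_trans; [apply Cmod_add|].
    destruct (Nat.eqb_spec K 0) as [->|_].
    + pose proof (lam_ge_self 0 t Ht). lra.
    + rewrite Cmod_zero. lra.
  - rewrite Csum_zero.
    + destruct (Nat.eqb_spec K 0) as [->|_]; [now destruct HK|].
      replace (Cadd C0 C0) with C0 by ring. rewrite Cmod_zero. lra.
    + intros l _. unfold incr. destruct (Nat.eqb_spec (pri l t) K) as [E|]; auto.
      now apply pri_self in E.
Qed.

(* [piece N K] has mean zero on each cell of level [K] if [K > 0]. *)
Lemma integ_piece_fej N K n x : (0 < K)%nat -> (n <= Mk m K)%nat ->
  Cinteg m N (fun t => Cmul (piece N K t) (fej n x t)) = C0.
Proof.
  intros HK Hn.
  rewrite (Cinteg_ext m hm N _ (fun t => Csum N (fun l => Cmul (incr K l t) (fej n x t)))).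
  2: { intros t _. rewrite Csum_mul_r. unfold piece. destruct K; [lia|]. simpl. ring. }
  rewrite (Cinteg_sum m N N (fun l t => Cmul (incr K l t) (fej n x t))).
  apply Csum_zero. intros l Hl.
  destruct (Nat.lt_ge_cases l K) as [Hlt|Hge].
  - apply Cinteg_zero; auto. intros t _. unfold incr. pose proof (pri_le l t).
    destruct (Nat.eqb_spec (pri l t) K); [lia|ring].
  (* As [n <= M_K <= M_l], the kernel is constant on cells of level [l], where the increment of
     level [l] averages to zero. *)
  - assert (HF : fdep m l (fej n x)).
    { apply fej_fdep. pose proof (Mk_le m hm K l Hge). lia. }
    rewrite (Cinteg_dep m hm (S l) N); [|..|lia].
    + rewrite Cinteg_S by auto. apply Cinteg_zero; auto. intros t Ht.
      rewrite (Csum_ext _ _ (fun q => Cmul (Cmul (if Nat.eqb (pri l t) K then Cone else C0)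
         (fej n x t)) (Cadd (f (S l) (upd t l q)) (Copp (f l t))))).
      * rewrite Csum_mul_l, Csum_plus, Csum_const, !Cscal_mul.
        transitivity (Cmul (Cmul (if Nat.eqb (pri l t) K then Cone else C0) (fej n x t))
          (Cadd (f l t) (Cmul (Cmul (/ INR (m l), 0) (INR (m l), 0)) (Copp (f l t))))).
        { rewrite (mart_step l t Ht) at 2. rewrite Cscal_mul. ring. }
        replace (Cmul (/ INR (m l), 0) (INR (m l), 0)) with Cone; [ring|].
        pose proof (m_ge2 m hm l). apply Cx_eq; simpl; field; lra.
      * intros q Hq. unfold incr.
        rewrite (fdep_cond m l (pri l)), (fdep_cond m l (fej n x)), (fdep_cond m l (f l))
          by auto using pri_fdep, mart_fdep.
        destruct (Nat.eqb (pri l t) K); ring.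
    + intros t t' Ht Ht' H. unfold incr.
      rewrite (HF t t'), (pri_fdep l t t'), (mart_fdep (S l) t t'), (mart_fdep l t t'); auto.
Qed.

(** The least level with [n < M_A] has [M_(A-1) <= n], hence [M_A <= B * n]. *)
Lemma level_exists n N : (1 <= n <= N)%nat ->
  exists A, (A <= N)%nat /\ (n < Mk m A)%nat /\ MR A <= B * INR n.
Proof.
  intros [Hn HN].
  assert (H : (n < Mk m N)%nat) by (pose proof (Mk_gt m hm N); lia).
  clear HN. induction N as [|N IH]; [simpl in H; lia|].
  destruct (Nat.lt_ge_cases n (Mk m N)) as [Hlt|Hge].
  - destruct (IH Hlt) as [A [HA ?]]. exists A. split; auto.
  - exists (S N). repeat split; auto. rewrite MR_S.
    apply le_INR in Hge. pose proof (hB N). pose proof (m_ge2 m hm N).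
    apply Rmult_le_compat; auto; [lra|]. apply Rlt_le, MR_pos; auto.
Qed.

(** For [M_K <= n], replacing the kernel by [wker K] costs [M_A / M_K <= B * n / M_K], and this [n]
    cancels the [1 / n] of the Fejer mean. *)
Lemma fejer_bound n N x : (1 <= n <= N)%nat -> in_Gm m x ->
  Cmod (fejer m f n x) <=
  Rsum N (fun K => if Nat.leb (Mk m K) n
    then B / MR K * Rinteg m N (fun t => height K t * wker m B K x t) else 0).
Proof.
  intros Hn Hx. assert (Hn0 : 0 < INR n) by (apply lt_0_INR; lia).
  rewrite (fejer_integ n N) by lia.
  rewrite (Cinteg_ext m hm N _ (fun t => Csum N (fun K => Cmul (piece N K t) (fej n x t)))).
  2: { intros t _. rewrite Csum_mul_r, sum_piece; [reflexivity|lia]. }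
  rewrite (Cinteg_sum m N N (fun K t => Cmul (piece N K t) (fej n x t))).
  rewrite Cmod_scal, Rabs_pos_eq by (apply Rlt_le, Rinv_0_lt_compat; auto).
  apply Rmult_le_reg_l with (INR n); auto.
  rewrite <- Rmult_assoc, Rinv_r, Rmult_1_l, <- Rsum_scal by lra.
  eapply Rle_trans; [apply Cmod_Csum|]. apply Rsum_le. intros K HK.
  pose proof (MR_pos m hm K) as HMK.
  destruct (Nat.leb_spec (Mk m K) n) as [Hle|Hgt].
  - destruct (level_exists n N Hn) as [A [HA [HnA HMA]]].
    assert (HKA : (K <= A)%nat).
    { destruct (Nat.lt_ge_cases A K) as [HAK|]; auto.
      pose proof (Mk_le m hm A K). lia. }
    eapply Rle_trans; [apply Cmod_Cinteg; auto|].
    apply Rle_trans with (Rinteg m N (fun t => height K t * fej_bound m B A x t)).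
    { apply Rinteg_le; auto. intros t Ht. rewrite Cmod_mul.
      apply Rmult_le_compat; auto using Cmod_ge0, Cmod_piece.
      apply (Cmod_fej m hm B hB); auto. }
    pose proof (integ_maj m hm B hB N K (height K) x (fun t _ => height_nonneg K t)
      (height_fdep K) Hx A (conj HKA HA)) as HI.
    set (I := Rinteg m N (fun t => height K t * wker m B K x t)) in *.
    assert (HI0 : 0 <= I).
    { apply Rinteg_nonneg; auto. intros t _.
      apply Rmult_le_pos; [apply height_nonneg|apply (wker_nonneg m hm B hB)]. }
    apply Rmult_le_reg_l with (MR K); auto.
    eapply Rle_trans; [exact HI|].
    replace (MR K * (INR n * (B / MR K * I))) with (B * INR n * I) by (field; lra).
    apply Rmult_le_compat_r; auto.
  (* [M_K > n >= 1] excludes [K = 0], the one piece without mean zero. *)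
  - rewrite Rmult_0_r, integ_piece_fej; [rewrite Cmod_zero; lra|..]; [|lia].
    destruct K; [simpl in Hgt; lia|lia].
Qed.

(** * The weighted maximal operator *)

Context (p : R) (hp : 0 < p < 1 / 2).

(** For [M_K <= n] the weight is at least [M_K ^ (1/p - 2)]. With the factor [1 / M_K] of
    [fejer_bound] and the cell measure [1 / M_K] this leaves [M_K ^ (-1/p)], whose [p]-th power is
    again the cell measure. *)
Lemma sigstar_bound N x : (1 <= N)%nat -> in_Gm m x ->
  sigstar_N m p f N x <=
  Rsum N (fun K => Rsum (Mk m K) (fun c =>
    B * Rpower (MR K) (- / p) * (height K (pt m K c) * wker m B K x (pt m K c)))).
Proof.
  intros HN Hx. unfold sigstar_N.
  destruct (Rmax_from_attained 1 (N - 1)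
    (fun n => Cmod (fejer m f n x) / Rpower (INR n + 1) (/ p - 2))) as [k [Hk ->]].
  set (n := (1 + k)%nat). assert (Hn : (1 <= n <= N)%nat) by lia.
  pose proof (B_ge2 m hm B hB) as HB.
  (* [p < 1/2] makes the weight increasing in [n]. *)
  assert (Hp2 : 0 < / p - 2).
  { assert (2 < / p); [|lra]. rewrite <- (Rinv_inv 2).
    apply Rinv_lt_contravar; [nra|lra]. }
  set (e := / p - 2) in *.
  pose proof (Rpower_pos (INR n + 1) e) as Hw.
  apply Rmult_le_reg_r with (Rpower (INR n + 1) e); auto.
  unfold Rdiv at 1. rewrite Rmult_assoc, Rinv_l, Rmult_1_r by lra.
  eapply Rle_trans; [apply (fejer_bound n N x Hn Hx)|].
  rewrite Rmult_comm, <- Rsum_scal. apply Rsum_le. intros K HK.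
  pose proof (MR_pos m hm K) as HMK.
  set (I := Rsum (Mk m K) (fun c => height K (pt m K c) * wker m B K x (pt m K c))).
  assert (HI : 0 <= I).
  { apply Rsum_nonneg. intros. apply Rmult_le_pos; [apply height_nonneg|].
    apply (wker_nonneg m hm B hB). }
  assert (E : Rsum (Mk m K) (fun c => B * Rpower (MR K) (- / p) *
      (height K (pt m K c) * wker m B K x (pt m K c))) = B * Rpower (MR K) (- / p) * I)
    by apply Rsum_scal.
  rewrite E. clear E.
  pose proof (Rpower_pos (MR K) (- / p)) as HP.
  assert (0 <= B * Rpower (MR K) (- / p) * I) by (repeat apply Rmult_le_pos; lra).
  destruct (Nat.leb_spec (Mk m K) n) as [Hle|_]; [|nra].
  rewrite (Rinteg_dep m hm K N); [|apply (fdep_mul m K); auto using height_fdep, wker_fdep|lia].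
  unfold Rinteg. fold I.
  assert (HMn : Rpower (MR K) e <= Rpower (INR n + 1) e).
  { apply Rle_Rpower_l; [lra|]. split; auto. apply le_INR in Hle. unfold Mreal. lra. }
  apply Rle_trans with (Rpower (MR K) e * (B * Rpower (MR K) (- / p) * I)).
  - replace (Rpower (MR K) e * (B * Rpower (MR K) (- / p) * I))
      with (B * I * (Rpower (MR K) e * Rpower (MR K) (- / p))) by ring.
    rewrite <- Rpower_plus. replace (e + - / p) with (- (1 + 1)) by (unfold e; ring).
    rewrite Rpower_Ropp, Rpower_plus, Rpower_1 by auto. fold (MR K). right. field. lra.
  - apply Rmult_le_compat_r; auto.
Qed.

(** * Summation over principal cells *)

Lemma lam_upd K t q : in_Gm m t -> (q < m K)%nat -> lam K (upd t K q) = lam K t.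
Proof. intros. apply (fdep_cond m K); auto using lam_fdep. Qed.

Definition hit (K : nat) (t : nat -> nat) : R :=
  if Rle_dec (lam K t) (Cmod (f (S K) t)) then 1 else 0.

(* Each cell of level [K] has a child, of proportion at least [1 / B], on which
   [|f (S K)|] reaches [lam K]. *)
Lemma integ_hit N K g : (K < N)%nat -> fdep m K g -> (forall t, in_Gm m t -> 0 <= g t) ->
  Rinteg m N g <= B * Rinteg m N (fun t => g t * hit K t).
Proof.
  intros HK Hg Hg0. rewrite (Rinteg_dep m hm K N g) by (auto; lia).
  rewrite (Rinteg_dep m hm (S K) N); [|..|lia].
  - rewrite Rinteg_S, <- Rinteg_scal by auto. apply Rinteg_le; auto. intros t Ht.
    pose proof (m_ge2 m hm K). pose proof (hB K).
    assert (H1 : g t <= Rsum (m K) (fun q => g (upd t K q) * hit K (upd t K q))).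
    { destruct (lam_attained K t) as [q [Hq E]].
      eapply Rle_trans; [|apply (Rsum_term_le (m K) q); auto].
      - cbv beta. rewrite (fdep_cond m K g) by auto. unfold hit. rewrite lam_upd by auto.
        destruct Rle_dec; [lra|lra].
      - intros i Hi. cbv beta. apply Rmult_le_pos; [apply Hg0, in_Gm_upd; auto|].
        unfold hit. destruct Rle_dec; lra. }
    specialize (Hg0 t Ht).
    set (S := Rsum (m K) (fun q => g (upd t K q) * hit K (upd t K q))) in *.
    apply Rle_trans with S; auto.
    replace S with (INR (m K) * (/ INR (m K) * S)) at 1 by (field; lra).
    apply Rmult_le_compat_r; auto. apply Rmult_le_pos; [|lra].
    apply Rlt_le, Rinv_0_lt_compat. lra.
  - intros t t' Ht Ht' H. unfold hit.
    rewrite (Hg t t'), (lam_fdep K t t'), (mart_fdep (S K) t t'); auto.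
Qed.

(** The sum of the geometric series of ratio [2 ^ (-p)], the factor gained on [lam ^ p] between
    nested principal cells. *)
Definition geo : R := / (1 - Rpower (/ 2) p).

Lemma geo_facts : 0 < geo /\ geo * Rpower (/ 2) p + 1 = geo.
Proof.
  assert (H : Rpower (/ 2) p < 1).
  { replace (/ 2) with (Rpower 2 (- (1))) by (rewrite Rpower_Ropp, Rpower_1; lra).
    rewrite Rpower_mult. apply Rpower_lt_1; lra. }
  unfold geo. split; [apply Rinv_0_lt_compat; lra|field; lra].
Qed.

(* On principal cells where [hit] holds, [lam] is at most [|f^*|], and it doubles from
   one principal cell to the next, so the sum is geometric. *)
Lemma sum_principal N n t : in_Gm m t -> (n < N)%nat ->
  Rsum (S n) (fun K => rpow (lam K t) p * eqi (pri K t) K * hit K t)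
  <= geo * rpow (lam (pri n t) t) p /\
  Rsum (S n) (fun K => rpow (lam K t) p * eqi (pri K t) K * hit K t)
  <= geo * rpow (fstar_N m f N t) p.
Proof.
  intros Ht. destruct geo_facts as [Hg0 Hg].
  assert (Hhit : forall K, hit K t = 1 -> (K < N)%nat ->
                 rpow (lam K t) p <= rpow (fstar_N m f N t) p).
  { intros K HK HKN. apply rpow_le; [lra|]. unfold hit in HK.
    destruct Rle_dec as [Hle|]; [|lra]. eapply Rle_trans; [exact Hle|].
    apply (Rmax_from_ge 0 N (fun n => Cmod (f n t)) (S K)). lia. }
  assert (Hcase : forall K, hit K t = 1 \/ hit K t = 0).
  { intros K. unfold hit. destruct Rle_dec; auto. }
  assert (Hgeo1 : 1 <= geo) by (pose proof (Rpower_pos (/ 2) p); nra).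
  (* Both bounds go through the induction together: the first feeds the doubling step and yields the
     second at a new principal level where [hit] holds; at any other level the sum does not grow. *)
  induction n as [|n IH]; intros Hn.
  - cbn [Rsum pri]. unfold eqi. simpl Nat.eqb. cbv iota.
    pose proof (rpow_nonneg (lam 0 t) p). pose proof (rpow_nonneg (fstar_N m f N t) p).
    destruct (Hcase 0%nat) as [E|E]; rewrite E.
    + specialize (Hhit 0%nat E ltac:(lia)). split; nra.
    + split; nra.
  - destruct (IH ltac:(lia)) as [IH1 IH2]. clear IH.
    cbn [Rsum] in *. set (s := Rsum n _ + _) in *. clearbody s.
    pose proof (pri_le n t) as Hpn.
    cbn [pri]. destruct Rlt_dec as [Hlt|Hge].
    + unfold eqi. rewrite Nat.eqb_refl.
      assert (Hr : rpow (lam (pri n t) t) p <= Rpower (/ 2) p * rpow (lam (S n) t) p).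
      { rewrite <- (rpow_Rpower (/ 2)) by lra. pose proof (lam_nonneg (S n) t).
        rewrite <- rpow_mul by lra. apply rpow_le; lra. }
      pose proof (rpow_nonneg (lam (S n) t) p).
      assert (Hs : s + rpow (lam (S n) t) p <= geo * rpow (lam (S n) t) p).
      { rewrite <- Hg at 1.
        apply Rle_trans with (geo * (Rpower (/ 2) p * rpow (lam (S n) t) p)
                              + rpow (lam (S n) t) p); [|lra].
        apply Rplus_le_compat_r. eapply Rle_trans; [exact IH1|].
        apply Rmult_le_compat_l; lra. }
      destruct (Hcase (S n)) as [E|E]; rewrite E.
      * specialize (Hhit (S n) E ltac:(lia)). split; [lra|]. nra.
      * split; lra.
    + unfold eqi. destruct (Nat.eqb_spec (pri n t) (S n)); [lia|]. split; lra.
Qed.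

(** The constants: [4 ^ p] from [height], [B] from moving each integral to where [lam] is attained,
    [geo] from the pointwise sum over levels. *)
Lemma integ_height_pow N : (1 <= N)%nat ->
  Rsum N (fun K => Rinteg m N (fun t => rpow (height K t) p))
  <= rpow 4 p * B * geo * Rinteg m N (fun t => rpow (fstar_N m f N t) p).
Proof.
  intros HN. pose proof (B_ge2 m hm B hB) as HB. pose proof (rpow_nonneg 4 p) as H4.
  apply Rle_trans with (Rsum N (fun K => rpow 4 p * B *
    Rinteg m N (fun t => rpow (lam K t) p * eqi (pri K t) K * hit K t))).
  - apply Rsum_le. intros K HK.
    rewrite (Rinteg_ext m hm N _ (fun t => rpow 4 p * (rpow (lam K t) p * eqi (pri K t) K))).
    + rewrite Rinteg_scal, Rmult_assoc. apply Rmult_le_compat_l; auto.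
      apply integ_hit; auto.
      * intros t t' Ht Ht' H. now rewrite (lam_fdep K t t'), (pri_fdep K t t').
      * intros t Ht. apply Rmult_le_pos; [apply rpow_nonneg|apply eqi_nonneg].
    + intros t Ht. unfold height. pose proof (lam_nonneg K t).
      rewrite !rpow_mul, rpow_eqi; auto using eqi_nonneg; try lra.
  - rewrite Rsum_scal, <- (Rinteg_sum m N N (fun K t =>
      rpow (lam K t) p * eqi (pri K t) K * hit K t)).
    rewrite (Rmult_assoc (rpow 4 p * B)). apply Rmult_le_compat_l; [nra|].
    rewrite <- Rinteg_scal. apply Rinteg_le; auto. intros t Ht.
    destruct N as [|n]; [lia|]. apply (sum_principal (S n) n t Ht). lia.
Qed.

(** Subadditivity moves the [p]-th power inside both sums of [sigstar_bound]. Integrating in [x]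
    bounds each [wker] factor by [c], and the sum over cells becomes the integral of
    [height ^ p]. *)
Lemma integ_sigstar N c : (1 <= N)%nat ->
  (forall K t, in_Gm m t -> (K <= N)%nat ->
     Rinteg m N (fun x => rpow (wker m B K x t) p) <= c) ->
  Rinteg m N (fun x => rpow (sigstar_N m p f N x) p)
  <= rpow B p * c * (rpow 4 p * B * geo) * Rinteg m N (fun t => rpow (fstar_N m f N t) p).
Proof.
  intros HN Hc. pose proof (B_ge2 m hm B hB) as HB.
  assert (Hc0 : 0 <= c).
  { eapply Rle_trans; [|apply (Hc 0%nat (fun _ => 0%nat)); [|lia]].
    - apply Rinteg_nonneg; auto. intros; apply rpow_nonneg.
    - intros k. specialize (hm k). lia. }
  pose proof (rpow_nonneg B p) as HBp.
  assert (Hterm : forall K c0 x, 0 <= B * Rpower (MR K) (- / p) *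
            (height K (pt m K c0) * wker m B K x (pt m K c0))).
  { intros K c0 x. pose proof (Rpower_pos (MR K) (- / p)).
    apply Rmult_le_pos; [nra|].
    apply Rmult_le_pos; [apply height_nonneg|apply (wker_nonneg m hm B hB)]. }
  apply Rle_trans with (Rinteg m N (fun x => Rsum N (fun K => Rsum (Mk m K) (fun c0 =>
    rpow B p * / MR K * rpow (height K (pt m K c0)) p * rpow (wker m B K x (pt m K c0)) p)))).
  - apply Rinteg_le; auto. intros x Hx.
    eapply Rle_trans; [apply rpow_le, (sigstar_bound N x HN Hx); lra|].
    eapply Rle_trans; [apply rpow_Rsum; [lra|]|].
    + intros K HK. apply Rsum_nonneg. intros; apply Hterm.
    + apply Rsum_le. intros K HK.
      eapply Rle_trans; [apply rpow_Rsum; [lra|]|].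
      * intros; apply Hterm.
      * apply Rsum_le. intros c0 Hc0'. right.
        pose proof (height_nonneg K (pt m K c0)).
        pose proof (wker_nonneg m hm B hB K x (pt m K c0)).
        pose proof (Rpower_pos (MR K) (- / p)). pose proof (MR_pos m hm K).
        rewrite !rpow_mul; try nra.
        rewrite (rpow_Rpower (Rpower (MR K) (- / p))), Rpower_mult by auto.
        replace (- / p * p) with (- (1)) by (field; lra).
        rewrite Rpower_Ropp, Rpower_1 by auto. ring.
  - rewrite (Rinteg_sum m N N (fun K x => Rsum (Mk m K) (fun c0 =>
      rpow B p * / MR K * rpow (height K (pt m K c0)) p * rpow (wker m B K x (pt m K c0)) p))).
    rewrite Rmult_assoc.
    apply Rle_trans with (rpow B p * c *
      Rsum N (fun K => Rinteg m N (fun t => rpow (height K t) p))).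
    + rewrite <- Rsum_scal. apply Rsum_le. intros K HK.
      rewrite (Rinteg_sum m N (Mk m K) (fun c0 x =>
        rpow B p * / MR K * rpow (height K (pt m K c0)) p * rpow (wker m B K x (pt m K c0)) p)).
      rewrite (Rinteg_dep m hm K N (fun t => rpow (height K t) p)); [|..|lia].
      2: { intros t t' Ht Ht' H. now rewrite (height_fdep K t t'). }
      unfold Rinteg at 2. rewrite <- !Rsum_scal. apply Rsum_le. intros c0 Hc0'.
      rewrite Rinteg_scal.
      specialize (Hc K (pt m K c0) (in_Gm_pt m hm K c0) ltac:(lia)).
      pose proof (rpow_nonneg (height K (pt m K c0)) p).
      assert (0 < / MR K) by (apply Rinv_0_lt_compat, MR_pos; auto).
      fold (MR K).
      replace (rpow B p * c * (/ MR K * rpow (height K (pt m K c0)) p))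
        with (rpow B p * / MR K * rpow (height K (pt m K c0)) p * c) by ring.
      apply Rmult_le_compat_l; auto. repeat apply Rmult_le_pos; lra.
    + apply Rmult_le_compat_l; [nra|]. now apply integ_height_pow.
Qed.

End Fejer.

Theorem theorem1 (m : nat -> nat) (p : R)
  (hm : bounded_gen_seq m) (hp : 0 < p < 1/2) :
  exists c : R, 0 < c /\
    forall f : nat -> (nat -> nat) -> Cx, is_martingale m f ->
      forall B : R, Hp_norm_le m p f B -> sigstar_norm_le m p f (c * B).
Proof.
  destruct hm as [h2 [b hb]].
  assert (hB : forall k, INR (m k) <= INR b) by (intros; now apply le_INR).
  pose proof (B_ge2 m h2 (INR b) hB) as HB.
  destruct (integ_wker_pow m h2 (INR b) hB p hp) as [c0 [Hc0 Hw]].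
  destruct (geo_facts p hp) as [Hg _].
  set (D := rpow (INR b) p * c0 * (rpow 4 p * INR b * geo p)).
  assert (HD : 0 < D).
  { unfold D. rewrite !rpow_Rpower by lra.
    pose proof (Rpower_pos (INR b) p). pose proof (Rpower_pos 4 p).
    repeat apply Rmult_lt_0_compat; lra. }
  (* [D] compares integrals of [p]-th powers; norms are compared after taking [p]-th roots. *)
  exists (rpow D (/ p)). split; [rewrite rpow_Rpower; auto using Rpower_pos|].
  intros f hf B HBf N HN. unfold Lp_at. specialize (HBf N). unfold Lp_at in HBf.
  assert (Hi : 0 <= Rinteg m N (fun x => rpow (fstar_N m f N x) p)).
  { apply Rinteg_nonneg; auto. intros; apply rpow_nonneg. }
  assert (Hp : 0 < / p) by (apply Rinv_0_lt_compat; lra).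
  eapply Rle_trans; [apply rpow_le; auto|].
  - apply (integ_sigstar m h2 (INR b) hB f hf p hp N c0 HN). intros; now apply Hw.
  - fold D. rewrite rpow_mul by lra. apply Rmult_le_compat_l; auto using rpow_nonneg.
Qed.
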